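(* Let $\theta>0$ and let $b:[0,\theta]\to\mathbb R$ be a $C^1$ function with $b'<0$. Let $g(a):=b(\theta-a)$, and let $(X,A^X)$ be the (unique) pair of continuous adapted processes with $A^X$ non-decreasing, $X_t\le g(A^X_t)$, and $$dX_t=(\sigma\rho\hat\sigma-\beta X_t)\,dt+\hat\sigma\,dB_t-dA^X_t,\quad X_0=g(0),$$ $$dA^X_t=\mathbf 1_{\{X_t=g(A^X_t)\}}\,dA^X_t,\quad A^X_0=0,$$ on the stochastic interval $[0,\tau^X_\theta]$, where for $\ell\in[0,\theta]$ $$\tau^X_\ell:=\inf\{t>0: A^X_t>\ell\ \text{ or }\ A^X_t=\theta\}.$$ Then for $\ell<\theta$ ($\ell\ge0$), $$\mathbb E\big[e^{-\delta\tau^X_\ell}\big]=\exp\left(\int_{\theta-\ell}^{\theta}\big(b'(x)-1\big)\frac{\Phi_\delta'(b(x))}{\Phi_\delta(b(x))}\,dx\right).$$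
   Context: Constants: $\sigma>0$, $\hat\sigma>0$, $\beta>0$, $\rho\in[-1,1]$, $\delta>0$. $B$ is a Brownian motion on a filtered probability space satisfying the usual conditions. The function $\Phi_\delta$ is $$\Phi_\delta(x):=H_{-\delta/\beta}\big((\sigma\rho\hat\sigma-\beta x)/(\sqrt\beta\,\hat\sigma)\big),$$ where for $\nu<0$ the Hermite function is $H_\nu(x)=\Gamma(-\nu)^{-1}\int_0^\infty e^{-t^2-2xt}t^{-\nu-1}\,dt$; it is, up to a constant factor, the unique positive increasing solution of $\frac{\hat\sigma^2}{2}\Phi''(x)+(\sigma\rho\hat\sigma-\beta x)\Phi'(x)-\delta\Phi(x)=0$. Existence and uniqueness of the strong solution $(X,A^X)$ up to $\tau^X_\theta$ is known. *)

(* Defs.v *)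
From HB Require Import structures.
From mathcomp Require Import all_boot all_order all_algebra.
From mathcomp Require Import all_classical all_reals all_analysis.

Set Implicit Arguments.
Unset Strict Implicit.
Unset Printing Implicit Defensive.

Import Order.TTheory GRing.Theory Num.Theory.
Import numFieldNormedType.Exports.

Local Open Scope classical_set_scope.
Local Open Scope ring_scope.

(* Time ranges over [0, +oo[, encoded as the t : R with 0 <= t: the values of a
   filtration or of a process at negative times are never constrained or used. *)

Section filtered_space.
Context {d : measure_display} {Omega : measurableType d} {R : realType}.
Variable P : probability Omega R.

Definition adapted (F : R -> set (set Omega)) (X : R -> Omega -> R) : Prop :=
  forall t : R, 0 <= t -> forall U : set R, measurable U -> F t (X t @^-1` U).

(* Completeness of P follows from [usual_complete] and [usual_sub], since
   P.-negligible sets are arbitrary subsets of measurable P-null sets. *)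
Record usual_filtration (F : R -> set (set Omega)) : Prop := {
  usual_sigma : forall t : R, 0 <= t -> sigma_algebra setT (F t) ;
  usual_sub : forall t : R, 0 <= t -> F t `<=` measurable ;
  usual_mono : forall s t : R, 0 <= s -> s <= t -> F s `<=` F t ;
  usual_right : forall t : R, 0 <= t -> \bigcap_(s in `]t, +oo[) F s `<=` F t ;
  usual_complete : forall N, P.-negligible N -> F 0 N }.

Definition continuous_path (X : R -> Omega -> R) (w : Omega) : Prop :=
  {within `[0, +oo[, continuous (fun t => X t w)}.

Definition incr (X : R -> Omega -> R) (s t : R) (w : Omega) : R :=
  X t w - X s w.

(* The second argument of [normal_prob] is the standard deviation. *)
Record brownian_motion (F : R -> set (set Omega)) (B : R -> Omega -> R)
    : Prop := {
  bm_adapted : adapted F B ;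
  bm_start : {ae P, forall w, B 0 w = 0} ;
  bm_continuous : {ae P, forall w, continuous_path B w} ;
  bm_normal : forall s t : R, 0 <= s -> s < t -> forall U : set R, measurable U ->
    P (incr B s t @^-1` U) = normal_prob 0 (Num.sqrt (t - s)) U ;
  bm_indep : forall s t : R, 0 <= s -> s < t ->
    forall E : set Omega, F s E -> forall U : set R, measurable U ->
    P (E `&` incr B s t @^-1` U) =
      (P E * P (incr B s t @^-1` U))%E }.

Definition tau (theta : R) (A : R -> Omega -> R) (l : R) (w : Omega) : \bar R :=
  ereal_inf [set t%:E | t in [set t | 0 < t /\ (l < A t w \/ A t w = theta)]].

(* dA_t = 1_{X_t = g(A_t)} dA_t on [0, T], in integrated form. The integral is
   against the Lebesgue-Stieltjes measure of the path of A, which takes as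
   argument a bundled nondecreasing right-continuous function on all of R; its
   values at negative times are irrelevant as only ]0, T] is measured. *)
Definition carried_by_contact (g : R -> R) (X A : R -> Omega -> R)
    (T : \bar R) (w : Omega) : Prop :=
  exists2 a : cumulative R R, (forall t : R, 0 <= t -> a t = A t w) &
    forall t : R, 0 <= t -> (t%:E <= T)%E ->
      (A t w - A 0 w)%:E = (\int[lebesgue_stieltjes_measure a]_(s in `]0%R, t])
        (\1_[set u | X u w = g (A u w)] s)%:E)%E.

(* Ornstein-Uhlenbeck process with drift kappa - beta x and volatility sh,
   reflected downwards at the boundary x = g(a). The diffusion coefficient is
   constant, so that the stochastic integral of sh is sh * B. *)
Record reflected_OU (F : R -> set (set Omega)) (B : R -> Omega -> R)
    (kappa beta sh theta : R) (g : R -> R) (X A : R -> Omega -> R) : Prop := {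
  rou_adapted : adapted F X /\ adapted F A ;
  rou_continuous : {ae P, forall w, continuous_path X w /\ continuous_path A w} ;
  rou_nondecreasing : {ae P, forall w,
    forall s t : R, 0 <= s -> s <= t -> A s w <= A t w} ;
  rou_start : {ae P, forall w, X 0 w = g 0 /\ A 0 w = 0} ;
  rou_below : {ae P, forall w,
    forall t : R, 0 <= t -> (t%:E <= tau theta A theta w)%E ->
      X t w <= g (A t w)} ;
  rou_dynamics : {ae P, forall w,
    forall t : R, 0 <= t -> (t%:E <= tau theta A theta w)%E ->
      X t w = X 0 w
        + \int[lebesgue_measure]_(s in `[0, t]) (kappa - beta * X s w)
        + sh * B t w - A t w} ;
  rou_contact : {ae P, forall w,
    carried_by_contact g X A (tau theta A theta w) w} }.

End filtered_space.

Section special_functions.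
Context {R : realType}.

Definition Gamma (z : R) : R :=
  \int[lebesgue_measure]_(t in `]0, +oo[) (t `^ (z - 1) * expR (- t)).

(* Meaningful for nu < 0 only; elsewhere the integrals diverge. *)
Definition hermite (nu x : R) : R :=
  (Gamma (- nu))^-1 * \int[lebesgue_measure]_(t in `]0, +oo[)
    (expR (- t ^+ 2 - 2 * x * t) * t `^ (- nu - 1)).

Definition Phi (sigma sh beta rho delta x : R) : R :=
  hermite (- delta / beta) ((sigma * rho * sh - beta * x) / (Num.sqrt beta * sh)).

(* b is C^1 on [0, theta] with derivative db, one-sided at the endpoints. *)
Definition C1_on (theta : R) (b db : R -> R) : Prop :=
  (forall x : R, x \in `[0, theta] ->
    (fun y => (b y - b x) / (y - x)) @ within `[0, theta] x^' --> db x) /\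
  {within `[0, theta], continuous db}.

End special_functions.

(* Main.v *)
Require Import Defs.
From HB Require Import structures.
From mathcomp Require Import all_boot all_order all_algebra.
From mathcomp Require Import all_classical all_reals all_analysis.
From mathcomp Require Import measurable_realfun ring lra.

(** Let [L] be the logarithmic derivative of Phi, let g(a) = b(theta - a), and
    let f > 0 solve f' = f * (L o g) with f(0) * Phi(g 0) = 1.  Consider
    Z_t = exp(- delta t) f(A_t) Phi(X_t).  Between contacts X is a free
    Ornstein-Uhlenbeck process, for which exp(- delta t) Phi is invariant; at a
    contact X = g(A), and an increment of A changes Z in proportion to
    f'(A) Phi(X) - f(A) Phi'(X) = f(A) Phi(X) (L(g(A)) - L(X)) = 0.  So Z is a
    martingale, bounded up to tau_l, and E[Z at tau_l] = Z_0 = 1.  Since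
    X = g(l) and A = l at tau_l, this reads f(l) Phi(g l) E[exp(- delta tau_l)]
    = 1, and f(l) Phi(g l) is the exponential of minus the integral in the
    statement ([gauge_end]).

    The martingale property is proved on a time grid, without stochastic
    integrals.  Phi is a mixture of exponentials, and Gaussian exponential
    moments give an exact one-step identity for the free process
    ([psi_normal_tilt], [phi_step]): if the free process moves from x to X' in
    time h, then E[exp(- delta h) Phi(X')] = Phi(x).
    [gridsum] adds to the initial value of Z the increments which Z would have
    if, in each step, X followed the free transition driven by the same
    Brownian increment and A stayed constant.  Two facts about it suffice.

    - In the mean it is constant up to O(1/n): Brownian increments are
      independent of the past, so that the one-step identity applies to each
      increment ([freezing], [onestep], [gridsum_mean]).

    - On each path it is bounded, and it tends to the value of Z at the minimum
      of T and tau_l ([gridsum_bounded], [path_limit]).  The free and the true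
      step differ by the increment of A up to a small [defect], and the
      effect of that increment on Z is estimated by the mean value theorem
      ([step_mvt]), where contact makes the bracket L(g(A)) - L(X) small.

    Phi grows faster than exponentially and the discrete steps are unbounded,
    hence two precautions.  The argument of Phi is cut at a level K above the
    boundary, which costs an exponentially small amount ([phi_step_min]).  The
    sum is stopped as soon as A exceeds l, X exceeds an upper bound of the
    boundary or the total defect exceeds 1 ([alive]), which bounds it by a
    constant.  Dominated convergence in n, then T to infinity, gives
    [discounted_mean]. *)

Set Implicit Arguments.
Unset Strict Implicit.
Unset Printing Implicit Defensive.

Import Order.TTheory GRing.Theory Num.Theory.
Import numFieldNormedType.Exports.

Local Open Scope classical_set_scope.
Local Open Scope ring_scope.

(** * Measures and integrals on the line *)

Lemma image_measure d1 d2 (T1 : measurableType d1) (T2 : measurableType d2)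
    (R : realType) (mu : {measure set T1 -> \bar R}) (phi : T1 -> T2) :
  measurable_fun setT phi ->
  {nu : {measure set T2 -> \bar R} | forall A, nu A = mu (phi @^-1` A)}.
Proof.
move=> mphi.
by exists (measure_function_pushforward__canonical__measure_function_Measure
             mu mphi).
Qed.

Lemma lebesgue_measure_scale (R : realType) (r : R) (A : set R) : 0 < r ->
  measurable A ->
  lebesgue_measure ((fun x => r * x) @^-1` A) = (r^-1%:E * lebesgue_measure A)%E.
Proof.
move=> r0 mA.
have ms : measurable_fun setT
    (fun x : measurableTypeR R => (r * x)%R : measurableTypeR R).
  exact: measurable_funM.
have [sc scE] := image_measure lebesgue_measure ms.
pose nu : {measure set (measurableTypeR R) -> \bar R} :=
  mscale (NngNum (ltW r0)) sc.
have nuE B : nu B = (r%:E * lebesgue_measure ((fun x => (r * x)%R) @^-1` B))%E.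
  by rewrite -scE.
rewrite (@lebesgue_measure_unique R nu _ A mA); last first.
  move=> _ [[a b]] _ <-.
  rewrite nuE.
  rewrite (_ : _ @^-1` _ = `]a / r, b / r]%classic); last first.
    apply/seteqP; split => x/=; rewrite !in_itv/= ltr_pdivrMr// ler_pdivlMr//;
      by rewrite (mulrC r).
  rewrite !lebesgue_measure_itv/= !lte_fin ltr_pM2r ?invr_gt0//.
  case: ifPn => // _; last by rewrite mule0.
  by rewrite -!EFinB -EFinM; congr EFin; field; rewrite gt_eqF.
by rewrite nuE muleA -EFinM mulVf ?gt_eqF// mul1e.
Qed.

Lemma ge0_integral_scale (R : realType) (r : R) (f : R -> \bar R) : 0 < r ->
  measurable_fun setT f -> (forall x, 0 <= f x)%E ->
  (\int[lebesgue_measure]_(x in `]0%R, +oo[) f (r * x)%R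
   = r^-1%:E * \int[lebesgue_measure]_(x in `]0%R, +oo[) f x)%E.
Proof.
move=> r0 mf f0.
have ms : measurable_fun setT
    (fun x : measurableTypeR R => (r * x)%R : measurableTypeR R).
  exact: measurable_funM.
rewrite [X in integral _ X _](_ : _ =
    (fun x : measurableTypeR R => (r * x)%R : measurableTypeR R)
      @^-1` `]0%R, +oo[%classic); last first.
  by apply/seteqP; split => x/=; rewrite !in_itv/= !andbT pmulr_rgt0.
rewrite -(@ge0_integral_pushforward _ _ _ _ _ _ ms)//; last exact: measurable_funTS.
have -> : (\int[pushforward lebesgue_measure
    (fun x : measurableTypeR R => (r * x)%R : measurableTypeR R)]_(y in `]0%R, +oo[) f y
  = \int[mscale (NngNum (ltW (etrans (invr_gt0 r) r0))) lebesgue_measure]_(y in `]0%R, +oo[) f y)%E.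
  apply: eq_measure_integral => A mA _.
  by rewrite /pushforward /mscale/=; exact: lebesgue_measure_scale.
by rewrite ge0_integral_mscale//; exact: measurable_funTS.
Qed.

Import HBNNSimple.

(** Both sides agree on indicators by hypothesis, hence on simple functions, and
    monotone convergence extends the equality to nonnegative functions. *)
Lemma ge0_integral_density d (T : measurableType d) (R : realType)
    (mu nu : {measure set T -> \bar R}) (p : T -> R) :
  measurable_fun setT p -> (forall x, 0 <= p x) ->
  (forall A, measurable A -> nu A = \int[mu]_(x in A) (p x)%:E)%E ->
  forall f : T -> \bar R, measurable_fun setT f -> (forall x, 0 <= f x)%E ->
  (\int[nu]_x f x = \int[mu]_x (f x * (p x)%:E))%E.
Proof.
move=> mp p0 nuE f mf f0.
have ind E : measurable E ->
    (\int[nu]_x (\1_E x)%:E = \int[mu]_x ((\1_E x)%:E * (p x)%:E))%E.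
  move=> mE; rewrite integral_indic// setIT nuE// integral_mkcond.
  apply: eq_integral => x _; rewrite patchE indicE.
  by case: ifPn => _; rewrite ?mul1e ?mul0e.
pose f_ := nnsfun_approx measurableT mf.
have step n : (\int[nu]_x (f_ n x)%:E = \int[mu]_x ((f_ n x)%:E * (p x)%:E))%E.
  under [LHS]eq_integral do rewrite fimfunE -fsumEFin//.
  rewrite [LHS]ge0_integral_fsum//; last 2 first.
    - by move=> r; exact/measurable_EFinP/measurableT_comp.
    - by move=> m x _; rewrite EFinM nnfun_muleindic_ge0.
  under [RHS]eq_integral.
    move=> x xD; rewrite fimfunE -fsumEFin// muleC ge0_mule_fsumr; last first.
      by move=> r; rewrite EFinM nnfun_muleindic_ge0.
    over.
  rewrite [RHS]ge0_integral_fsum//; last 2 first.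
    - move=> r; apply: emeasurable_funM; first exact/measurable_EFinP.
      exact/measurable_EFinP/measurableT_comp.
    - move=> m x _; apply: mule_ge0; first by rewrite lee_fin.
      by rewrite EFinM nnfun_muleindic_ge0.
  apply: eq_fsbigr => r _.
  have [rneg|r0] := ltP r 0.
    rewrite preimage_nnfun0//.
    by rewrite !integral0_eq// => x _; rewrite indic0 mulr0 ?mule0.
  under eq_integral do rewrite EFinM.
  rewrite ge0_integralZl//; last exact/measurable_EFinP/measurable_indic.
  rewrite ind//.
  under [RHS]eq_integral do rewrite EFinM muleCA.
  rewrite [RHS]ge0_integralZl//.
  - by congr *%E; apply: eq_integral => x _; rewrite muleC.
  - apply: emeasurable_funM; first exact/measurable_EFinP.
    exact/measurable_EFinP/measurable_indic.
  - by move=> x _; rewrite mule_ge0 ?lee_fin.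
transitivity (lim (\int[nu]_x (f_ n x)%:E @[n --> \oo])%E).
  rewrite -monotone_convergence//=.
  - apply: eq_integral => ? /[!inE] xD; apply/esym/cvg_lim => //=.
    exact: cvg_nnsfun_approx.
  - by move=> n; exact/measurable_EFinP/measurable_funTS.
  - by move=> n ? _; rewrite lee_fin.
  - by move=> ? _ ? ? mn; rewrite lee_fin; exact/lefP/nd_nnsfun_approx.
rewrite (_ : (fun n => _) = (fun n => \int[mu]_x ((f_ n x)%:E * (p x)%:E))%E);
  last by apply/funext.
rewrite -monotone_convergence//=.
- apply: eq_integral => x _; apply/cvg_lim => //=.
  apply: cvgeZr => //; exact: cvg_nnsfun_approx.
- move=> n; apply: emeasurable_funM; first exact/measurable_EFinP/measurable_funTS.
  exact/measurable_EFinP.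
- by move=> n x _; rewrite mule_ge0 ?lee_fin.
- move=> x _ a b ab; apply: lee_pmul => //; rewrite ?lee_fin//.
  exact/lefP/nd_nnsfun_approx.
Qed.

(** Heine's theorem, by covering compactness applied to the property that a given
    modulus d works at x. *)
Lemma uniform_continuity_itv (R : realType) (f : R -> R) (a b : R) :
  {within `[a, b], continuous f} -> forall e, 0 < e ->
  exists2 d, 0 < d & forall x y, x \in `[a, b] -> y \in `[a, b] ->
    `|x - y| < d -> `|f x - f y| < e.
Proof.
move=> cf e e0.
have /compact_near_coveringP cov := @segment_compact R a b.
pose Q (d x : R) := forall y, x \in `[a, b] -> y \in `[a, b] ->
    `|x - y| < d -> `|f x - f y| < e.
have : \forall d \near 0^'+, `[a, b] `<=` Q d.
  apply: cov => x xab.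
  have /cvgrPdist_lt/(_ (e / 2)) : f @ within `[a, b] (nbhs x) --> f x.
    by move/subspace_continuousP: cf; exact.
  rewrite divr_gt0// => /(_ isT)/nbhs_ballP[/= r r0 fr].
  exists (ball x (r / 2), [set d : R | 0 < d < r / 2]) => /=.
    split; first by apply: nbhsx_ballx; rewrite divr_gt0.
    near=> d; apply/andP; split => //.
    by near: d; apply: nbhs_right_lt; rewrite divr_gt0.
  move=> [z d] /= [xz /andP[d0 dr]] y zab yab zyd.
  have xy : `|x - y| < r.
    rewrite (le_lt_trans (ler_distD z _ _))// [ltRHS]splitr ltrD//.
    exact: lt_trans dr.
  have := fr z; have := fr y; rewrite /ball/= => /(_ xy yab) fy.
  move/(_ _ zab); rewrite (lt_trans xz) ?ltr_pdivrMr ?ltr_pMr ?ltr1n// => /(_ isT) fz.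
  rewrite (le_lt_trans (ler_distD (f x) _ _))// [ltRHS]splitr ltrD//.
  by rewrite distrC.
move=> H.
suff [d [d0 dQ]] : exists d, 0 < d /\ `[a, b] `<=` Q d.
  by exists d => // x y xab; exact: dQ.
near (0 : R)^'+ => d; exists d; split => //.
by near: d.
Unshelve. all: by end_near. Qed.

(** * Parabolic cylinder integrals *)

(** With the integral below, Hermite's function of order - a without its
    normalising factor: H_(-a)(y) = [psi a y] / Gamma(a). *)
Definition hkern (R : realType) (a y t : R) : R :=
  expR (- t ^+ 2 - 2 * y * t) * t `^ (a - 1).

Definition psi (R : realType) (a y : R) : R :=
  \int[lebesgue_measure]_(t in `]0, +oo[) hkern a y t.

Lemma powR_le_expR (R : realType) (a : R) : 0 < a ->
  exists2 K, 0 <= K & forall t : R, 0 < t -> t `^ a <= K * expR (t / 4).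
Proof.
move=> a0; exists ((4 * a) `^ a); first exact: powR_ge0.
move=> t t0.
have b0 : 0 < 4 * a by rewrite mulr_gt0.
have -> : expR (t / 4) = expR (t / (4 * a)) `^ a.
  by rewrite -expRM; congr expR; field; rewrite gt_eqF.
rewrite -powRM ?expR_ge0 ?(ltW b0)//; apply: (ge0_ler_powR (ltW a0)); rewrite ?nnegrE ?(ltW t0)//.
  by rewrite mulr_ge0 ?expR_ge0 ?(ltW b0).
rewrite mulrC -ler_pdivrMr//; have := expR_ge1Dx (t / (4 * a)); lra.
Qed.

(** The function t^(a-1) exp(- t) is dominated by a multiple of
    a t^(a-1) / (1 + t^a)^2, which is the derivative of the bounded function
    - 1 / (1 + t^a).  This treats the singularity at 0 and the decay at infinity
    together. *)
Lemma integrable_gamma (R : realType) (a : R) : 0 < a ->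
  lebesgue_measure.-integrable `]0, +oo[
    (EFin \o (fun t : R => t `^ (a - 1) * expR (- t))).
Proof.
move=> a0; have [K K0 tK] := powR_le_expR a0.
pose F (t : R) : R := - (1 + t `^ a)^-1.
pose rho (t : R) : R := a * t `^ (a - 1) / (1 + t `^ a) ^+ 2.
have den (t : R) : 0 < 1 + t `^ a by rewrite ltr_wpDr// powR_ge0.
have rho0 t : 0 <= rho t.
  by rewrite /rho divr_ge0 ?sqr_ge0// mulr_ge0 ?powR_ge0// ltW.
have mg : measurable_fun setT (fun t : R => t `^ (a - 1) * expR (- t)).
  apply: measurable_funM; first exact: measurable_powR.
  by apply: measurableT_comp => //; exact: measurable_expR.
have mrho : measurable_fun setT rho.
  have -> : rho = (fun t => a * t `^ (a - 1) * (1 + t `^ a) `^ (- 2%:R)).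
    by apply/funext => t; rewrite /rho powR_invn// ltW.
  have mp p : measurable_fun setT (fun t : R => t `^ p) by exact: measurable_powR.
  apply: measurable_funM; first exact: measurable_funM.
  by apply: (measurableT_comp (mp _)); exact: measurable_funD.
have d1 (t : R) : 0 < t -> is_derive t 1 (fun t => 1 + t `^ a) (a * t `^ (a - 1)).
  move=> t0; have h := is_derive1_powR a t0.
  by have := is_deriveD (is_derive_cst (1 : R) t 1) h; rewrite add0r.
have dF (t : R) : 0 < t -> is_derive t 1 F (rho t).
  move=> t0; have h := d1 t t0.
  have h2 := @is_deriveV _ (fun t : R => 1 + t `^ a) _ _ _ (lt0r_neq0 (den t)) h.
  have -> : rho t = - (- (1 + t `^ a) ^- 2 *: (a * t `^ (a - 1))).
    by rewrite /rho /GRing.scale/= mulNr opprK mulrC.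
  exact: is_deriveN.
have drho (t : R) : 0 < t -> derivable rho t 1.
  move=> t0; have h := d1 t t0.
  apply: derivableM.
    by apply: derivableM => //; apply: derivable_powR; rewrite in_itv/= t0.
  apply: derivableV; first by rewrite gt_eqF// exprn_gt0.
  have [hd _] := h; exact: (@derivableX _ _ (fun t : R => 1 + t `^ a) 2 t 1 hd).
pose I n : set R := `[n.+1%:R^-1, n.+2%:R]%classic.
have Frho n : (\int[lebesgue_measure]_(x in I n) (rho x)%:E <= 1)%E.
  have n0 : 0 < n.+1%:R^-1 :> R by rewrite invr_gt0.
  have cF x : 0 < x -> {for x, continuous F}.
    move=> x0; apply: differentiable_continuous; apply/derivable1_diffP.
    by have [] := dF x x0.
  have nn : n.+1%:R^-1 < n.+2%:R :> R.
    by rewrite (@le_lt_trans _ _ 1)// ?ltr1n// invf_le1// ler1n.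
  rewrite (@continuous_FTC2 _ rho F)//.
  - rewrite -EFinB lee_fin /F opprK.
    rewrite (@le_trans _ _ (1 + n.+1%:R^-1 `^ a)^-1)//.
      by rewrite gerDr oppr_le0 invr_ge0 ltW.
    by rewrite invf_le1// lerDl powR_ge0.
  - apply: derivable_within_continuous => x; rewrite in_itv/= => /andP[nx _].
    exact/drho/(lt_le_trans n0).
  - split.
    + move=> x; rewrite in_itv/= => /andP[nx _].
      by have [] := dF x (lt_trans n0 nx).
    + by apply: cvg_at_right_filter; exact: cF.
    + by apply: cvg_at_left_filter; apply: cF; exact: lt_trans nn.
  - move=> x; rewrite in_itv/= => /andP[xn _]; rewrite derive1E.
    by have [_ ->] := dF x (lt_trans n0 xn).
have U : `]0%R, +oo[%classic = \bigcup_n I n.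
  apply/seteqP; split => [x/=|x [n _]]; rewrite /I/= !in_itv/= ?andbT; last first.
    by move=> /andP[nx _]; exact: lt_le_trans nx.
  move=> x0; exists (maxn (Num.truncn x) (Num.truncn x^-1)) => //=.
  rewrite in_itv/=; apply/andP; split.
    rewrite -[leRHS]invrK lef_pV2 ?posrE ?invr_gt0//.
    apply: (le_trans (ltW (truncnS_gt _))); rewrite ler_nat ltnS.
    exact: leq_maxr.
  apply: (le_trans (ltW (truncnS_gt _))); rewrite ler_nat ltnS.
  by rewrite ltnW// ltnS leq_maxl.
have intrho : (\int[lebesgue_measure]_(x in `]0%R, +oo[) (rho x)%:E <= 1)%E.
  have ndI : nondecreasing_seq I.
    apply/nondecreasing_seqP => n; apply/subsetPset => x; rewrite /I/= !in_itv/=.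
    move=> /andP[nx xn]; apply/andP; split.
      by apply: le_trans nx; rewrite lef_pV2 ?posrE// ler_nat.
    by apply: (le_trans xn); rewrite ler_nat.
  have := @ge0_nondecreasing_set_cvg_integral _ (measurableTypeR R) R I (EFin \o rho)
    lebesgue_measure ndI.
  rewrite -U => /(_ (fun=> measurable_itv _)) cvI.
  have {}cvI : (\int[lebesgue_measure]_(x in I i) (rho x)%:E)%E @[i --> \oo] -->
      (\int[lebesgue_measure]_(x in `]0%R, +oo[) (rho x)%:E)%E.
    apply: cvI => [n|n x _]; last by rewrite lee_fin.
    by apply/measurable_EFinP; exact: measurable_funTS.
  rewrite -(cvg_lim _ cvI)//; apply: lime_le; last exact: nearW.
  by apply/cvg_ex; eexists; exact: cvI.
apply/integrableP; split; first by apply/measurable_EFinP; exact: measurable_funTS.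
pose C := a^-1 * (1 + K) ^+ 2.
have C0 : 0 <= C by rewrite /C mulr_ge0 ?invr_ge0 ?sqr_ge0// ltW.
apply: (@le_lt_trans _ _ (\int[lebesgue_measure]_(x in `]0%R, +oo[) (C%:E * (rho x)%:E))%E).
  apply: ge0_le_integral => //=.
  - by do 2 apply: measurableT_comp => //; exact: measurable_funTS.
  - apply: emeasurable_funM => //; apply/measurable_EFinP; exact: measurable_funTS.
  - move=> x; rewrite in_itv/= andbT => x0; rewrite -EFinM lee_fin.
    rewrite ger0_norm ?mulr_ge0 ?powR_ge0 ?expR_ge0// /rho /C.
    have -> : a^-1 * (1 + K) ^+ 2 * (a * x `^ (a - 1) / (1 + x `^ a) ^+ 2) =
       x `^ (a - 1) * ((1 + K) ^+ 2 / (1 + x `^ a) ^+ 2).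
      by field; rewrite !gt_eqF.
    rewrite ler_wpM2l ?powR_ge0// ler_pdivlMr ?exprn_gt0//.
    rewrite mulrC expRN ler_pdivrMr ?expR_gt0//.
    have -> : expR x = expR (x / 2) ^+ 2.
      by rewrite -expRM_natl; congr expR; lra.
    rewrite -exprMn ler_sqr ?nnegrE ?mulr_ge0 ?expR_ge0 ?addr_ge0 ?powR_ge0//.
    rewrite mulrDl mul1r lerD//.
      by rewrite -expR0 ler_expR divr_ge0// ltW.
    rewrite (le_trans (tK _ x0))// ler_wpM2l// ler_expR; lra.
rewrite ge0_integralZl//.
- apply: (@le_lt_trans _ _ (C%:E * 1)%E); first by rewrite lee_wpmul2l.
  by rewrite mule1 ltry.
- by apply/measurable_EFinP; exact: measurable_funTS.
- by move=> x _; rewrite lee_fin.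
Qed.

Lemma Rintegral_gt0 (R : realType) (f : R -> R) :
  lebesgue_measure.-integrable `]0, +oo[ (EFin \o f) ->
  (forall t, 0 < t -> 0 < f t) ->
  0 < \int[lebesgue_measure]_(t in `]0, +oo[) f t.
Proof.
move=> intf f0.
have f00 t : `]0, +oo[%classic t -> 0 < f t.
  by rewrite /= in_itv/= andbT => /f0.
rewrite lt_def Rintegral_ge0 ?andbT; last by move=> t /f00/ltW.
apply/eqP => int0.
have mf := measurable_int _ intf.
have {int0} : (\int[lebesgue_measure]_(t in `]0%R, +oo[) `|(EFin \o f) t| = 0)%E.
  transitivity ((\int[lebesgue_measure]_(t in `]0, +oo[) f t)%:E); last by rewrite int0.
  rewrite /Rintegral fineK; last exact: integrable_fin_num.
  by apply: eq_integral => t /[!inE] /f00 t0; rewrite /= gtr0_norm.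
move/ae_eq_integral_abs => /(_ (measurable_itv _) mf) [N [mN N0 sub]].
have : (lebesgue_measure (`]0%R, 1%R]%classic : set R) <= lebesgue_measure N)%E.
  apply: le_measure; rewrite ?inE// => t/=; rewrite in_itv/= => /andP[t0 _].
  apply: sub => /= H; have /eqP : (f t)%:E = 0%E by apply: H; rewrite /= in_itv/= t0.
  by rewrite eqe gt_eqF ?f0.
by rewrite N0 lebesgue_measure_itv/= lte01 sube0 lee_fin ler10.
Qed.

Section psi.
Context {R : realType}.
Implicit Types a y t : R.

Let mpos : @measurable _ (measurableTypeR R) `]0, +oo[%classic.
Proof. exact: measurable_itv. Qed.

Lemma hkern_ge0 a y t : 0 <= hkern a y t.
Proof. by rewrite /hkern mulr_ge0 ?expR_ge0 ?powR_ge0. Qed.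

Lemma measurable_hkern a y : measurable_fun setT (hkern a y).
Proof.
apply: measurable_funM; last exact: measurable_powR.
apply: (measurableT_comp (@measurable_expR R)).
apply: measurable_funB; last exact: measurable_funM.
by apply: measurableT_comp => //; exact: measurable_funX.
Qed.

(** Completing the square, - t^2 - 2 y t is at most - t plus a constant, which
    reduces the claim to the Gamma integral. *)
Lemma integrable_hkern a y : 0 < a ->
  lebesgue_measure.-integrable `]0, +oo[ (EFin \o hkern a y).
Proof.
move=> a0; pose C := expR ((2 * y - 1) ^+ 2 / 4).
have := integrableZl mpos C (integrable_gamma a0).
apply: le_integrable => //.
  by apply/measurable_EFinP; apply: measurable_funTS; exact: measurable_hkern.
move=> t _ /=; rewrite lee_fin ger0_norm ?hkern_ge0// ger0_norm; last first.
  by rewrite !mulr_ge0 ?expR_ge0 ?powR_ge0.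
rewrite /hkern [X in _ <= _ * X]mulrC mulrA ler_wpM2r ?powR_ge0//.
rewrite -expRD ler_expR -subr_ge0.
by rewrite [leRHS](_ : _ = (t + (2 * y - 1) / 2) ^+ 2) ?sqr_ge0//; field.
Qed.

Lemma Gamma_gt0 a : 0 < a -> 0 < Gamma a.
Proof.
move=> a0; apply: Rintegral_gt0; first exact: integrable_gamma.
by move=> t t0; rewrite mulr_gt0 ?powR_gt0 ?expR_gt0.
Qed.

Lemma psi_gt0 a y : 0 < a -> 0 < psi a y.
Proof.
move=> a0; apply: Rintegral_gt0; first exact: integrable_hkern.
by move=> t t0; rewrite mulr_gt0 ?powR_gt0 ?expR_gt0.
Qed.

Lemma psiE a y : 0 < a ->
  (\int[lebesgue_measure]_(t in `]0%R, +oo[) (hkern a y t)%:E = (psi a y)%:E)%E.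
Proof.
move=> a0; rewrite fineK//; apply: integrable_fin_num => //.
exact: integrable_hkern.
Qed.

Lemma is_derive_hkern a y t : 0 < a -> 0 < t ->
  is_derive y 1 (fun y => hkern a y t) (- 2 * hkern (a + 1) y t).
Proof.
move=> a0 t0.
have h : is_derive y 1 (fun y : R => - t ^+ 2 - 2 * y * t) (- (2 * t)).
  have -> : (fun y : R => - t ^+ 2 - 2 * y * t) =
      (cst (- (2 * t)) * id + cst (- t ^+ 2)).
    by apply/funext => z; rewrite !fctE /=; ring.
  have := is_deriveD (is_deriveM (is_derive_cst (- (2 * t)) y 1) (is_derive_id y 1))
    (is_derive_cst (- t ^+ 2) y 1).
  by rewrite scaler0 !addr0 /GRing.scale/= mulr1.
have h2 := @is_derive1_comp _ expR (fun y : R => - t ^+ 2 - 2 * y * t) y _ _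
  (is_derive_expR (- t ^+ 2 - 2 * y * t)) h.
have := is_deriveM h2 (is_derive_cst (t `^ (a - 1)) y 1).
rewrite scaler0 add0r /GRing.scale/=.
have -> // : t `^ (a - 1) * (expR (- t ^+ 2 - 2 * y * t) * - (2 * t)) =
  - 2 * hkern (a + 1) y t.
by rewrite /hkern addrK -(mulr_powRB1 (ltW t0) a0); ring.
Qed.

Lemma ler_hkern a y1 y2 t : 0 < t -> y1 <= y2 -> hkern a y2 t <= hkern a y1 t.
Proof.
move=> t0 y12; rewrite ler_wpM2r ?powR_ge0// ler_expR lerD2l lerN2.
by rewrite ler_pM2r// ler_pM2l.
Qed.

(** Differentiation under the integral sign: near y the derivatives in y are
    dominated by the kernel at y - 1, which decreases in its parameter. *)
Lemma is_derive_psi a y : 0 < a -> is_derive y 1 (psi a) (- 2 * psi (a + 1) y).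
Proof.
move=> a0.
have a10 : 0 < a + 1 by rewrite addr_gt0.
have Iy : `]y - 1, y + 1[%classic y by rewrite /= in_itv/=; apply/andP; split; lra.
have t0P t : `]0, +oo[%classic t -> 0 < t by rewrite /= in_itv/= andbT.
have dE z t : `]0, +oo[%classic t ->
    partial1of2 (hkern a) z t = - 2 * hkern (a + 1) z t.
  move=> /t0P t0; rewrite /partial1of2 derive1E.
  by have [_ ->] := is_derive_hkern z a0 t0.
have D1 (x t : R) : `]y - 1, y + 1[%classic x -> `]0, +oo[%classic t ->
    derivable (hkern a ^~ t) x 1.
  by move=> _ /t0P t0; have [] := is_derive_hkern x a0 t0.
have I1 (x : R) : `]y - 1, y + 1[%classic x ->
    lebesgue_measure.-integrable `]0, +oo[ (EFin \o hkern a x).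
  by move=> _; exact: integrable_hkern.
pose G t := 2 * hkern (a + 1) (y - 1) t.
have G0 (t : R) : 0 <= G t by rewrite mulr_ge0 ?hkern_ge0.
have intG : lebesgue_measure.-integrable `]0, +oo[ (EFin \o G).
  exact: (integrableZl mpos 2 (integrable_hkern (y - 1) a10)).
have Gub (x t : R) : `]y - 1, y + 1[%classic x -> `]0, +oo[%classic t ->
    `|partial1of2 (hkern a) x t| <= G t.
  move=> /=; rewrite in_itv/= => /andP[yx _] t0; rewrite dE// mulNr normrN.
  rewrite ger0_norm; last by apply: mulr_ge0 => //; exact: hkern_ge0.
  rewrite /G ler_pM2l//.
  by apply: ler_hkern; [exact: t0P|exact: ltW].
split; first exact: (derivable_under_integral _ Iy I1 D1 G0 intG Gub).
rewrite -derive1E (differentiation_under_integral _ Iy I1 D1 G0 intG Gub)//.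
rewrite /psi -RintegralZl//; last exact: integrable_hkern.
by apply: eq_Rintegral => t /[!inE] t0; rewrite dE.
Qed.

Lemma continuous_psi a : 0 < a -> continuous (psi a).
Proof.
move=> a0 y; apply: differentiable_continuous; apply/derivable1_diffP.
by have [] := is_derive_psi y a0.
Qed.

Lemma ler_psi a y1 y2 : 0 < a -> y1 <= y2 -> psi a y2 <= psi a y1.
Proof.
move=> a0 y12; apply: le_Rintegral => //; try exact: integrable_hkern.
by move=> t /=; rewrite in_itv/= andbT => t0; exact: ler_hkern.
Qed.

(** Multiplying a centred Gaussian density by an exponential gives, up to a
    constant, the density of another Gaussian. *)
Lemma integral_expR_normal (s lam : R) : 0 < s ->
  (\int[normal_prob 0 s]_z (expR (lam * z))%:E = (expR (lam ^+ 2 * s ^+ 2 / 2))%:E)%E.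
Proof.
move=> s0; have sn : s != 0 by rewrite gt_eqF.
rewrite (@ge0_integral_density _ _ R lebesgue_measure _ (normal_pdf 0 s))//.
- have E z : normal_pdf 0 s z * expR (lam * z) =
     expR (lam ^+ 2 * s ^+ 2 / 2) * normal_pdf (lam * s ^+ 2) s z.
    rewrite !normal_pdfE// /normal_fun.
    rewrite /= -(mulrA (normal_peak s)) -expRD (mulrCA _ (normal_peak s)) -expRD.
    congr (_ * expR _).
    by field.
  under eq_integral do rewrite muleC -EFinM E EFinM.
  rewrite ge0_integralZl//.
  + by rewrite integral_normal_pdf mule1.
  + by apply/measurable_EFinP; exact: measurable_normal_pdf.
  + by move=> x _; rewrite lee_fin normal_pdf_ge0.
- exact: measurable_normal_pdf.
- by move=> x; exact: normal_pdf_ge0.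
- apply/measurable_EFinP; apply: (measurableT_comp (@measurable_expR R)).
  exact: measurable_funM.
Qed.

(** By Tonelli the Gaussian expectation can be taken inside [psi], where it acts
    on exponentials.  The moment of exp(2 t s z) contributes
    exp(2 s^2 h t^2) = exp((1 - r^2) t^2), which turns the factor exp(- t^2) of
    the kernel into exp(- (r t)^2); the change of variables r t restores the
    kernel and produces the power of r.  The case lam = 0 is the invariance of
    exp(- delta t) Phi; the exponential weight with lam > 0 serves to bound the
    contribution of large z. *)
Lemma psi_normal_tilt a (r s h lam y : R) : 0 < a -> 0 < r -> 0 < h ->
  2 * s ^+ 2 * h = 1 - r ^+ 2 ->
  (\int[normal_prob 0 (Num.sqrt h)]_z (psi a (r * y - s * z) * expR (lam * s * z))%:E
   = (r `^ (- a) * expR (lam ^+ 2 * s ^+ 2 * h / 2)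
       * psi a (y - lam * s ^+ 2 * h / r))%:E)%E.
Proof.
move=> a0 r0 h0 sh.
have sq0 : 0 < Num.sqrt h by rewrite sqrtr_gt0.
pose pos : set (measurableTypeR R) := `]0, +oo[%classic.
pose H (p : R * measurableTypeR R) : \bar R :=
  (hkern a (r * y - s * p.1) p.2 * expR (lam * s * p.1) * \1_pos p.2)%:E.
have msnd : measurable_fun setT (fun p : R * measurableTypeR R => p.2 : R).
  exact: measurable_snd.
have mH : measurable_fun setT H.
  apply/measurable_EFinP; apply: measurable_funM; last first.
    have mi : measurable_fun setT (\1_pos : measurableTypeR R -> R).
      exact: measurable_indic.
    exact: (measurableT_comp mi measurable_snd).
  apply: measurable_funM; last first.
    by apply: (measurableT_comp (@measurable_expR R)); exact: measurable_funM.
  apply: measurable_funM; last exact: (measurableT_comp (measurable_powR (a - 1)) msnd).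
  apply: (measurableT_comp (@measurable_expR R)).
  apply: measurable_funB.
    by apply: measurableT_comp => //; exact: measurable_funX.
  apply: measurable_funM => //; apply: measurable_funM => //.
  by apply: measurable_funB => //; exact: measurable_funM.
have H0 p : (0 <= H p)%E.
  by rewrite lee_fin; apply: mulr_ge0 => //; apply: mulr_ge0;
    [exact: hkern_ge0|exact: expR_ge0].
transitivity (\int[normal_prob 0 (Num.sqrt h)]_z \int[lebesgue_measure]_t H (z, t))%E.
  apply: eq_integral => z _; rewrite EFinM -psiE// -ge0_integralZr//; last 2 first.
  - by apply/measurable_EFinP; apply: measurable_funTS; exact: measurable_hkern.
  - by move=> t _; rewrite lee_fin hkern_ge0.
  rewrite integral_mkcond; apply: eq_integral => t _.
  rewrite /H patchE/= indicE; rewrite -/pos.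
  by case: (t \in pos); rewrite ?mulr1 ?mulr0.
rewrite (fubini_tonelli (m1 := normal_prob 0 (Num.sqrt h))
  (m2 := lebesgue_measure) H mH H0).
pose y' := y - lam * s ^+ 2 * h / r.
pose c := r `^ (1 - a) * expR (lam ^+ 2 * s ^+ 2 * h / 2).
have c0 : 0 <= c by rewrite mulr_ge0 ?powR_ge0 ?expR_ge0.
transitivity (\int[lebesgue_measure]_(t in pos) (c%:E * (hkern a y' (r * t))%:E))%E.
  rewrite [RHS]integral_mkcond; apply: eq_integral => t _.
  rewrite /H patchE/= indicE; rewrite -/pos.
  case tp : (t \in pos); last by rewrite integral0_eq// => z _; rewrite mulr0.
  under eq_integral do rewrite mulr1.
  have t0 : 0 < t by have := set_mem tp; rewrite /pos/= in_itv/= andbT.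
  have E z : hkern a (r * y - s * z) t * expR (lam * s * z) =
     hkern a (r * y) t * expR ((2 * t + lam) * s * z).
    rewrite /hkern mulrAC [RHS]mulrAC -!expRD; congr (expR _ * _); ring.
  under eq_integral do rewrite E EFinM.
  rewrite ge0_integralZl//; last 2 first.
  - apply/measurable_EFinP; apply: (measurableT_comp (@measurable_expR R)).
    exact: measurable_funM.
  - by rewrite lee_fin hkern_ge0.
  rewrite integral_expR_normal// sqr_sqrtr ?(ltW h0)// -!EFinM; congr EFin.
  rewrite /c /hkern powRM ?(ltW r0) ?(ltW t0)//.
  have -> : 1 - a = - (a - 1) by rewrite opprB.
  rewrite powRN.
  have rp : r `^ (a - 1) != 0 by rewrite gt_eqF// powR_gt0.
  rewrite mulrAC -expRD.
  have -> : (r `^ (a - 1))^-1 * expR (lam ^+ 2 * s ^+ 2 * h / 2) *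
     (expR (- (r * t) ^+ 2 - 2 * y' * (r * t)) * (r `^ (a - 1) * t `^ (a - 1))) =
     expR (lam ^+ 2 * s ^+ 2 * h / 2 + (- (r * t) ^+ 2 - 2 * y' * (r * t)))
       * t `^ (a - 1) by rewrite [in RHS]expRD; field.
  congr (expR _ * _); rewrite /y'.
  have -> : - (r * t) ^+ 2 = - t ^+ 2 + 2 * s ^+ 2 * h * t ^+ 2.
    by rewrite sh; ring.
  by field; rewrite gt_eqF.
rewrite ge0_integralZl//.
- rewrite (@ge0_integral_scale _ _ (EFin \o hkern a y'))//=.
  + rewrite psiE// -!EFinM /c; congr EFin.
    rewrite (_ : 1 - a = - a + 1) 1?addrC// powRD; last by rewrite (gt_eqF r0) implybT.
    by rewrite powRr1 ?(ltW r0)//; field; rewrite gt_eqF.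
  + by apply/measurable_EFinP; exact: measurable_hkern.
  + by move=> t; rewrite lee_fin hkern_ge0.
- apply/measurable_EFinP; apply: measurable_funTS.
  by apply: (measurableT_comp (measurable_hkern _ _)); exact: measurable_funM.
- by move=> t _; rewrite lee_fin hkern_ge0.
Qed.
End psi.

(** * The eigenfunction of the Ornstein-Uhlenbeck generator *)

Section phi.
Context {R : realType} (kappa beta sh delta c0 : R).
Context (beta0 : 0 < beta) (sh0 : 0 < sh) (delta0 : 0 < delta) (c00 : 0 < c0).
Implicit Types x y z h : R.

Let al := delta / beta.
Let al0 : 0 < al. Proof. by rewrite divr_gt0. Qed.
Let al10 : 0 < al + 1. Proof. by rewrite addr_gt0. Qed.
Let sb := Num.sqrt beta.
Let sb0 : 0 < sb. Proof. by rewrite sqrtr_gt0. Qed.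
Let sb2 : sb ^+ 2 = beta. Proof. by rewrite sqr_sqrtr// ltW. Qed.

(** The argument of Hermite's function in Phi; [c0] stands for its normalising
    factor. *)
Definition ycoord x : R := (kappa - beta * x) / (Num.sqrt beta * sh).
Definition phi x : R := c0 * psi (delta / beta) (ycoord x).
Definition dphi x : R :=
  c0 * (2 * Num.sqrt beta / sh) * psi (delta / beta + 1) (ycoord x).

Lemma ler_ycoord x y : x <= y -> ycoord y <= ycoord x.
Proof.
move=> xy; rewrite ler_pM2r ?invr_gt0 ?mulr_gt0//.
by rewrite lerD2l lerN2 ler_pM2l.
Qed.

Lemma phi_gt0 x : 0 < phi x.
Proof. by rewrite mulr_gt0// psi_gt0. Qed.

Lemma dphi_gt0 x : 0 < dphi x.
Proof. by rewrite /dphi !mulr_gt0 ?invr_gt0 ?psi_gt0. Qed.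

Lemma ler_phi x y : x <= y -> phi x <= phi y.
Proof. by move=> xy; rewrite ler_pM2l// ler_psi// ler_ycoord. Qed.

(** Phi is convex, so that Phi' at K is a Lipschitz constant of Phi below K
    ([lip_ph_min]). *)
Lemma ler_dphi x y : x <= y -> dphi x <= dphi y.
Proof.
move=> xy; rewrite ler_pM2l; first by rewrite ler_psi// ler_ycoord.
by rewrite !mulr_gt0 ?invr_gt0.
Qed.

Lemma is_derive_ycoord x : is_derive x 1 ycoord (- (sb / sh)).
Proof.
have -> : ycoord = cst (- (sb / sh)) * id + cst (kappa / (sb * sh)).
  apply/funext => z; rewrite !fctE /ycoord -/sb -[in LHS]sb2; field.
  by rewrite !gt_eqF.
have := is_deriveD (is_deriveM (is_derive_cst (- (sb / sh)) x 1) (is_derive_id x 1))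
  (is_derive_cst (kappa / (sb * sh)) x 1).
by rewrite scaler0 !addr0 /GRing.scale/= mulr1.
Qed.

Lemma is_derive_phi x : is_derive x 1 phi (dphi x).
Proof.
have h := @is_derive1_comp _ (psi al) ycoord x _ _
  (is_derive_psi (ycoord x) al0) (is_derive_ycoord x).
have := is_deriveM (is_derive_cst c0 x 1) h.
rewrite scaler0 addr0 /GRing.scale/= => H.
have -> : dphi x = c0 * (- 2 * psi (al + 1) (ycoord x) * - (sb / sh)).
  by rewrite /dphi -/al -/sb; field; rewrite gt_eqF.
exact: H.
Qed.

Lemma continuous_dphi : continuous dphi.
Proof.
move=> x; apply: cvgM; first exact: cvg_cst.
apply: (continuous_comp (f := ycoord)); last exact: continuous_psi.
apply: differentiable_continuous; apply/derivable1_diffP.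
by have [] := is_derive_ycoord x.
Qed.

Lemma continuous_phi : continuous phi.
Proof.
move=> x; apply: differentiable_continuous; apply/derivable1_diffP.
by have [] := is_derive_phi x.
Qed.

Lemma measurable_phi : measurable_fun setT phi.
Proof. exact: continuous_measurable_fun continuous_phi. Qed.

(** Over a time step h, the process dX = (kappa - beta X) dt + sh dB started at x
    is normal with mean [ou_mean h x] and standard deviation
    sh * [ou_vol h] * sqrt h.  The factor sqrt h is left out of [ou_vol] so that
    sh * [ou_vol h] multiplies a Brownian increment. *)
Definition ou_mean h x : R := expR (- beta * h) * x + kappa / beta * (1 - expR (- beta * h)).
Definition ou_vol h : R := Num.sqrt ((1 - expR (- beta * h) ^+ 2) / (2 * beta * h)).

Lemma oneB_expRN (x : R) : 0 <= x -> x - x ^+ 2 <= 1 - expR (- x) <= x.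
Proof.
move=> x0; apply/andP; split; last by have := expR_ge1Dx (- x); lra.
have x1 : 0 < 1 + x by rewrite ltr_wpDr.
have : expR (- x) <= (1 + x)^-1.
  by rewrite expRN lef_pV2 ?posrE ?expR_gt0// expR_ge1Dx.
have : (1 + x)^-1 <= 1 - x + x ^+ 2.
  rewrite -[leLHS]mul1r ler_pdivrMr//.
  have -> : (1 - x + x ^+ 2) * (1 + x) = 1 + x ^+ 3 by ring.
  by rewrite lerDl exprn_ge0.
lra.
Qed.

Lemma ou_vol_sq h : 0 < h -> 1 - 2 * beta * h <= ou_vol h ^+ 2 <= 1.
Proof.
move=> h0.
have bh0 : 0 < 2 * beta * h by rewrite !mulr_gt0.
have e2 : expR (- beta * h) ^+ 2 = expR (- (2 * beta * h)).
  by rewrite -expRM_natl; congr expR; ring.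
have /andP[l u] := oneB_expRN (ltW bh0).
rewrite /ou_vol e2 sqr_sqrtr; last first.
  by rewrite divr_ge0 ?(ltW bh0)// subr_ge0 expR_le1 oppr_le0 (ltW bh0).
rewrite ler_pdivlMr// ler_pdivrMr// mul1r u andbT.
apply: le_trans l; rewrite -subr_ge0.
by rewrite [leRHS](_ : _ = 0)//; field.
Qed.

Lemma ou_volE h : 0 < h -> 2 * (sb * ou_vol h) ^+ 2 * h = 1 - expR (- beta * h) ^+ 2.
Proof.
move=> h0; rewrite /ou_vol exprMn sb2 sqr_sqrtr; last first.
  rewrite divr_ge0 ?mulr_ge0 ?(ltW h0) ?(ltW beta0)//.
  rewrite subr_ge0 exprn_ile1 ?expR_ge0// expR_le1 mulNr oppr_le0.
  by rewrite ltW ?mulr_gt0.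
by field; rewrite (gt_eqF beta0) (gt_eqF h0).
Qed.

Lemma ycoord_step h x z :
  ycoord (ou_mean h x + sh * ou_vol h * z) =
  expR (- beta * h) * ycoord x - sb * ou_vol h * z.
Proof.
rewrite /ycoord /ou_mean -/sb -sb2; field.
by rewrite !gt_eqF.
Qed.

Lemma phi_step_tilt h lam x : 0 < h ->
  (\int[normal_prob 0 (Num.sqrt h)]_z (phi (ou_mean h x + sh * ou_vol h * z)
       * expR (lam * (sb * ou_vol h) * z))%:E
   = (expR (delta * h) * expR (lam ^+ 2 * (sb * ou_vol h) ^+ 2 * h / 2)
     * (c0 * psi al (ycoord x - lam * (sb * ou_vol h) ^+ 2 * h / expR (- beta * h))))%:E)%E.
Proof.
move=> h0.
have E z : phi (ou_mean h x + sh * ou_vol h * z) * expR (lam * (sb * ou_vol h) * z) =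
  c0 * (psi al (expR (- beta * h) * ycoord x - (sb * ou_vol h) * z)
   * expR (lam * (sb * ou_vol h) * z)).
  by rewrite /phi ycoord_step -mulrA.
under eq_integral do rewrite E EFinM.
rewrite ge0_integralZl//; last 3 first.
- apply/measurable_EFinP; apply: measurable_funM.
    apply: (measurableT_comp (continuous_measurable_fun (continuous_psi al0))).
    by apply: measurable_funB => //; exact: measurable_funM.
  by apply: (measurableT_comp (@measurable_expR R)); exact: measurable_funM.
- by move=> z _; rewrite lee_fin mulr_ge0 ?expR_ge0 ?ltW ?psi_gt0.
- by rewrite lee_fin ltW.
rewrite psi_normal_tilt ?expR_gt0 ?ou_volE// -EFinM; congr EFin.
have -> : expR (- beta * h) `^ (- al) = expR (delta * h).
  by rewrite -expRM; congr expR; rewrite /al; field; rewrite gt_eqF.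
by ring.
Qed.

Local Opaque psi ou_vol phi.

(** exp(- delta t) Phi is invariant under the transitions of the free process:
    this is the integrated form of the differential equation for Phi. *)
Lemma phi_step h x : 0 < h ->
  (\int[normal_prob 0 (Num.sqrt h)]_z (phi (ou_mean h x + sh * ou_vol h * z))%:E
   = (expR (delta * h) * phi x)%:E)%E.
Proof.
move=> h0; have := phi_step_tilt 0 x h0.
under eq_integral do rewrite !mul0r expR0 mulr1.
by move=> ->; rewrite expr0n !mul0r expR0 mulr1 subr0.
Qed.

Lemma measurable_phi_min (K m c : R) :
  measurable_fun setT (fun z => phi (Num.min (m + c * z) K)).
Proof.
apply: (measurableT_comp measurable_phi).
by apply: measurable_minr => //; apply: measurable_funD => //; exact: measurable_funM.
Qed.

(** Cutting the argument at K only loses the event that the new position u exceeds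
    K.  There 1 <= exp(la (u - K)) for every la >= 0 (Chernoff), and
    [phi_step_tilt] evaluates the expectation of Phi(u) exp(la (u - K)) exactly.
    With la of order 1 / sqrt h the tilted integral stays bounded, while the
    factor exp(la (gm - K)) is exponentially small in 1 / sqrt h. *)
Lemma phi_step_min (gm K T : R) : gm < K -> 0 < T ->
  exists2 C, 0 <= C & forall h x, 0 < h -> h <= T -> x <= gm ->
    `|expR (- (delta * h)) * \int[normal_prob 0 (Num.sqrt h)]_z
         phi (Num.min (ou_mean h x + sh * ou_vol h * z) K) - phi x|
    <= C * expR (- ((K - gm) * sb / sh / Num.sqrt h)).
Proof.
move=> gK T0.
pose D := `|kappa / beta - gm|.
pose P := psi al (ycoord gm - Num.sqrt T * beta * expR (beta * T)).
exists (expR (Num.sqrt T * (sb / sh) * beta * D) * expR (beta / 2) * (c0 * P)).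
  by rewrite !mulr_ge0 ?expR_ge0// ltW// psi_gt0.
move=> h x h0 hT xg.
have q0 : 0 < Num.sqrt h by rewrite sqrtr_gt0.
have qq : Num.sqrt h ^+ 2 = h by rewrite sqr_sqrtr// ltW.
have qT : Num.sqrt h <= Num.sqrt T by rewrite ler_wsqrtr.
pose u z := ou_mean h x + sh * ou_vol h * z.
pose N := normal_prob 0 (Num.sqrt h).
have full : (\int[N]_z (phi (u z))%:E = (expR (delta * h) * phi x)%:E)%E.
  exact: phi_step.
have mtr : measurable_fun setT (EFin \o (fun z => phi (Num.min (u z) K))).
  by apply/measurable_EFinP; exact: measurable_phi_min.
have mfull : measurable_fun setT (EFin \o (fun z => phi (u z))).
  apply/measurable_EFinP; apply: (measurableT_comp measurable_phi).
  by apply: measurable_funD => //; exact: measurable_funM.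
have phi0 y : 0 <= phi y by exact/ltW/phi_gt0.
pose J := \int[N]_z phi (Num.min (u z) K).
have trle : (\int[N]_z (phi (Num.min (u z) K))%:E <= (expR (delta * h) * phi x)%:E)%E.
  rewrite -full; apply: ge0_le_integral => //.
  - by move=> z _; rewrite lee_fin.
  - by move=> z _; rewrite lee_fin ler_phi// ge_min lexx.
have JE : (\int[N]_z (phi (Num.min (u z) K))%:E = J%:E)%E.
  rewrite /J /Rintegral fineK// ge0_fin_numE.
    exact: le_lt_trans trle (ltry _).
  by apply: integral_ge0 => z _; rewrite lee_fin.
rewrite JE lee_fin in trle.
(* This tilt keeps W bounded as h tends to 0: its Gaussian exponent contains
   lam ^+ 2 * h, which is 1. *)
pose lam := (Num.sqrt h)^-1.
have tilt := phi_step_tilt lam x h0.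
set W := (X in _ = X%:E) in tilt.
pose la' := lam * sb / sh.
have la0 : 0 < la' by rewrite /la' !mulr_gt0// invr_gt0.
(* Pointwise in z, the full value is at most the cut value plus the value
   weighted by exp (la' * (u z - K)). *)
have tail : expR (delta * h) * phi x <= J + expR (la' * (ou_mean h x - K)) * W.
  rewrite -lee_fin EFinD (EFinM _ W) -tilt -JE -full -ge0_integralZl//; last 2 first.
  - apply/measurable_EFinP; apply: measurable_funM; first exact/measurable_EFinP.
    by apply: (measurableT_comp (@measurable_expR R)); exact: measurable_funM.
  - by move=> z _; rewrite lee_fin mulr_ge0 ?expR_ge0.
  rewrite -ge0_integralD//; last 3 first.
  - by move=> z _; rewrite lee_fin.
  - by move=> z _; rewrite -EFinM lee_fin mulr_ge0 ?expR_ge0// mulr_ge0 ?expR_ge0.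
  - apply: emeasurable_funM => //.
    apply/measurable_EFinP; apply: measurable_funM; first exact/measurable_EFinP.
    by apply: (measurableT_comp (@measurable_expR R)); exact: measurable_funM.
  apply: ge0_le_integral => //.
  - by move=> z _; rewrite lee_fin.
  - apply: emeasurable_funD => //; apply: emeasurable_funM => //.
    apply/measurable_EFinP; apply: measurable_funM; first exact/measurable_EFinP.
    by apply: (measurableT_comp (@measurable_expR R)); exact: measurable_funM.
  - move=> z _; rewrite -EFinM -EFinD lee_fin -/(u z).
    have -> : expR (la' * (ou_mean h x - K)) * (phi (u z) * expR (lam * (sb * ou_vol h) * z))
       = phi (u z) * expR (la' * (u z - K)).
      rewrite mulrCA -expRD; congr (_ * expR _); rewrite /la' /u; field.
      by rewrite gt_eqF.
    have [uK|Ku] := leP (u z) K; first by rewrite lerDl mulr_ge0 ?expR_ge0.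
    rewrite (@le_trans _ _ (phi (u z) * expR (la' * (u z - K))))//; last by rewrite lerDr.
    rewrite ler_pMr ?phi_gt0//.
    by rewrite -[leLHS](expR0 R) ler_expR mulr_ge0 ?(ltW la0)// subr_ge0 ltW.
have r0 := expR_gt0 (- beta * h).
have ed := expR_gt0 (delta * h).
have bh : 0 <= beta * h by rewrite mulr_ge0 ?ltW.
have /andP[_ rb] := oneB_expRN bh.
have /andP[_ vol1] := ou_vol_sq h0.
have mean_le : ou_mean h x <= gm + beta * h * D.
  have : ou_mean h x <= ou_mean h gm by rewrite lerD2r ler_pM2l.
  move=> /le_trans; apply.
  have -> : ou_mean h gm = gm + (1 - expR (- beta * h)) * (kappa / beta - gm).
    by rewrite /ou_mean; ring.
  rewrite lerD2l (le_trans (ler_norm _))// normrM ler_wpM2r//.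
  rewrite mulNr ger0_norm// subr_ge0 expR_le1; lra.
have W_le : W <= expR (delta * h) * expR (beta / 2) * (c0 * P).
  rewrite /W ler_pM ?mulr_ge0 ?expR_ge0 ?(ltW c00) ?(ltW (psi_gt0 _ _))//.
    rewrite ler_pM2l// ler_expR exprMn sb2 /lam exprVn qq.
    have -> : h^-1 * (beta * ou_vol h ^+ 2) * h / 2 = beta / 2 * ou_vol h ^+ 2.
      by field; rewrite gt_eqF.
    by rewrite ler_piMr// divr_ge0// ltW.
  rewrite ler_pM2l// /P ler_psi// lerB//; first exact: ler_ycoord.
  have -> : lam * (sb * ou_vol h) ^+ 2 * h / expR (- beta * h)
     = Num.sqrt h * (beta * ou_vol h ^+ 2) * expR (beta * h).
    rewrite mulNr expRN invrK exprMn sb2 -[X in _ * X * expR _]qq /lam; field.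
    by rewrite gt_eqF.
  have v1 : beta * ou_vol h ^+ 2 <= beta by rewrite ler_piMr// ltW.
  have v0 : 0 <= beta * ou_vol h ^+ 2 by rewrite mulr_ge0 ?sqr_ge0 ?(ltW beta0).
  apply: ler_pM; rewrite ?expR_ge0//.
  - exact: (mulr_ge0 (ltW q0) v0).
  - by apply: ler_pM => //; exact: ltW.
  - by rewrite ler_expR ler_pM2l.
have la_le : expR (la' * (ou_mean h x - K)) <=
    expR (Num.sqrt T * (sb / sh) * beta * D) * expR (- ((K - gm) * sb / sh / Num.sqrt h)).
  rewrite -expRD ler_expR.
  apply: (@le_trans _ _ (la' * (gm + beta * h * D - K))).
    by rewrite ler_pM2l// lerB.
  have -> : la' * (gm + beta * h * D - K) = Num.sqrt h * (sb / sh) * beta * D +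
      - ((K - gm) * sb / sh / Num.sqrt h).
    rewrite /la' /lam -[X in beta * X * D]qq; field.
    by rewrite !gt_eqF.
  have D0 : 0 <= D by exact: normr_ge0.
  have ss0 : 0 <= sb / sh by rewrite divr_ge0 ?ltW.
  rewrite lerD2r; apply: ler_wpM2r => //; apply: ler_wpM2r; first exact: ltW.
  exact: ler_wpM2r.
have dE : phi x = expR (- (delta * h)) * (expR (delta * h) * phi x).
  by rewrite mulrA -expRD addNr expR0 mul1r.
rewrite distrC [in X in X - _]dE -mulrBr ger0_norm; last first.
  by rewrite mulr_ge0 ?expR_ge0// subr_ge0.
apply: (@le_trans _ _ (expR (- (delta * h)) * (expR (la' * (ou_mean h x - K)) * W))).
  by rewrite ler_wpM2l ?expR_ge0// lerBlDl.
have := ler_pM (expR_ge0 _) _ la_le W_le => /(_ _)/(ler_wpM2l (expR_ge0 (- (delta * h)))).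
move=> H; apply: le_trans (H _) _; last first.
  rewrite expRN le_eqVlt; apply/orP; left; apply/eqP.
  by field; rewrite gt_eqF.
by rewrite /W !mulr_ge0 ?expR_ge0 ?(ltW c00) ?(ltW (psi_gt0 _ _)).
Qed.

Lemma expRN_le_pow4 (x : R) : 0 < x -> expR (- x) <= 256 / x ^+ 4.
Proof.
move=> x0; rewrite expRN.
have -> : expR x = expR (x / 4) ^+ 4.
  by rewrite -expRM_natl; congr expR; lra.
have x4 : 0 < x / 4 by rewrite divr_gt0.
have : x / 4 <= expR (x / 4) by have := expR_ge1Dx (x / 4); lra.
move=> xe; have -> : 256 / x ^+ 4 = ((x / 4) ^+ 4)^-1.
  by field; rewrite gt_eqF.
rewrite lef_pV2 ?posrE ?exprn_gt0 ?expR_gt0//.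
by rewrite lerXn2r ?nnegrE ?expR_ge0 ?(ltW x4).
Qed.

(** An error of order 1 / n^2 per step remains negligible after summing over n
    steps; exp(- c / sqrt h) is bounded by a multiple of (sqrt h)^4 = h^2. *)
Lemma phi_step_grid (gm K T : R) : gm < K -> 0 < T ->
  exists2 C, 0 <= C & forall n x, x <= gm ->
    forall h, h = T / n.+1%:R ->
    `|expR (- (delta * h)) * \int[normal_prob 0 (Num.sqrt h)]_z
         phi (Num.min (ou_mean h x + sh * ou_vol h * z) K) - phi x|
    <= C / n.+1%:R ^+ 2.
Proof.
move=> gK T0; have [C C0 HC] := phi_step_min gK T0.
pose g := (K - gm) * sb / sh.
have g0 : 0 < g by rewrite /g !mulr_gt0 ?subr_gt0 ?invr_gt0.
exists (C * (256 * T ^+ 2 / g ^+ 4)).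
  apply: mulr_ge0; first exact: C0.
  apply: divr_ge0; last exact/exprn_ge0/ltW.
  by apply: mulr_ge0; [exact: ler0n|exact: sqr_ge0].
move=> n x xg h hE.
have n0 : 0 < n.+1%:R :> R by rewrite ltr0n.
have h0 : 0 < h by rewrite hE divr_gt0.
have hT : h <= T by rewrite hE ler_pdivrMr// ler_peMr ?ler1n// ltW.
apply: (le_trans (HC h x h0 hT xg)).
have q0 : 0 < Num.sqrt h by rewrite sqrtr_gt0.
have -> : C * (256 * T ^+ 2 / g ^+ 4) / n.+1%:R ^+ 2 =
    C * (256 / (g / Num.sqrt h) ^+ 4).
  have -> : 256 / (g / Num.sqrt h) ^+ 4 = 256 * (Num.sqrt h ^+ 2) ^+ 2 / g ^+ 4.
    by field; rewrite !gt_eqF.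
  rewrite sqr_sqrtr ?(ltW h0)// hE.
  move: n0; move: (n.+1%:R : R) => m m0; field.
  by rewrite (gt_eqF g0) (gt_eqF m0).
by rewrite ler_wpM2l// expRN_le_pow4// divr_gt0.
Qed.
End phi.

(** * Deterministic estimates for one step *)

(** Living increments add up to at most b n; and at a living index b is at most c,
    while a dead index adds nothing, so that the sum never passes c.  The minimum
    of b n and c is the invariant of the induction. *)
Lemma sum_stopped_increments (R : realType) (alive : nat -> bool) (b : nat -> R)
    (c : R) (n : nat) : 0 <= c -> 0 <= b 0 ->
  (forall i, (i < n)%N -> b i <= b i.+1) ->
  (forall i, (i <= n)%N -> alive i -> b i <= c) ->
  \sum_(i < n) (alive i.+1)%:R * (b i.+1 - b i) <= c.
Proof.
move=> c0 b0 bS bc.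
suff : \sum_(i < n) (alive i.+1)%:R * (b i.+1 - b i) <= Num.min (b n) c.
  by move=> /le_trans; apply; rewrite ge_min lexx orbT.
elim: n bS bc => [|n IH] bS bc; first by rewrite big_ord0 le_min b0.
rewrite big_ord_recr/=.
have {}IH := IH (fun i h => bS i (ltnW h)) (fun i h => bc i (leqW h)).
have bn := bS n (ltnSn n).
case: (alive n.+1) (bc n.+1 (leqnn _)) => [/(_ isT) bnc|_]; rewrite ?mul1r ?mul0r ?addr0.
  move: IH; rewrite !le_min => /andP[h _]; apply/andP; split; lra.
by apply: (le_trans IH); rewrite le_min !ge_min bn lexx orbT.
Qed.

Section static.
Context {R : realType} (ph dph g f : R -> R) (l gm K : R).
Context (l0 : 0 <= l) (gmK : gm + l <= K).
Context (ph_gt0 : forall x, 0 < ph x) (dph_ge0 : forall x, 0 <= dph x)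
  (ler_dph : forall x y, x <= y -> dph x <= dph y)
  (der_ph : forall x : R, is_derive x 1 ph (dph x)) (cont_dph : continuous dph).
Context (g_cont : {within `[0, l], continuous g})
  (g_le : forall a, 0 <= a <= l -> g a <= gm).
Context (f_ge0 : forall a, 0 <= a <= l -> 0 <= f a) (f_cont : continuous f)
  (f_der : forall a : R, 0 < a < l -> is_derive a 1 f (f a * (dph (g a) / ph (g a)))).

Definition logder y := dph y / ph y.

Lemma cont_ph : continuous ph.
Proof.
move=> x; apply: differentiable_continuous; apply/derivable1_diffP.
by have [] := der_ph x.
Qed.

Lemma cont_logder : continuous logder.
Proof.
move=> x; apply: cvgM; first exact: cont_dph.
by apply: cvgV; [rewrite gt_eqF|exact: cont_ph].
Qed.

Lemma ler_ph x y : x <= y -> ph x <= ph y.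
Proof.
move=> xy.
have [c _ E] : exists2 c, c \in `[x, y] & ph y - ph x = dph c * (y - x).
  apply: MVT_segment => //; exact/continuous_subspaceT/cont_ph.
by rewrite -subr_ge0 E mulr_ge0// subr_ge0.
Qed.

Lemma lip_ph_min x y : `|ph (Num.min x K) - ph (Num.min y K)| <= dph K * `|x - y|.
Proof.
wlog xy : x y / x <= y.
  move=> H; have [/H//|/ltW/H] := leP x y.
  by rewrite distrC (distrC x).
have mxy : Num.min x K <= Num.min y K by rewrite le_min !ge_min xy lexx/= orbT.
have [c cI E] : exists2 c, c \in `[Num.min x K, Num.min y K] &
    ph (Num.min y K) - ph (Num.min x K) = dph c * (Num.min y K - Num.min x K).
  apply: MVT_segment => //; exact/continuous_subspaceT/cont_ph.
move: cI; rewrite in_itv/= => /andP[_ cy].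
have cK : c <= K by apply: (le_trans cy); rewrite ge_min lexx orbT.
rewrite distrC E ger0_norm; last by rewrite mulr_ge0// subr_ge0.
apply: ler_pM => //; [by rewrite subr_ge0|exact: ler_dph|].
rewrite distrC ger0_norm ?subr_ge0//.
by rewrite /Num.min; case: ifPn; case: ifPn; rewrite -?leNgt => *; lra.
Qed.

(** Interpolate by q(r) = f(a + r) ph(x + e - r) between a step in which the level
    jumps by e and one in which it stays.  As f' = f (L o g) and ph' = L ph, the
    derivative of q is f ph (L(g(a + r)) - L(x + e - r)), small when x is close
    to the boundary g(a). *)
Lemma step_mvt a e x : 0 <= a -> 0 <= e -> a + e <= l ->
  exists a' x', [/\ a <= a' <= a + e, x <= x' <= x + e &
    f a * ph (x + e) - f (a + e) * ph x =
      - (e * (f a' * ph x' * (logder (g a') - logder x')))].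
Proof.
move=> a0 e0 ael.
pose q r := f (a + r) * ph (x + e - r).
pose dq r := f (a + r) * ph (x + e - r) * (logder (g (a + r)) - logder (x + e - r)).
have cq : continuous q.
  move=> r; apply: cvgM.
    apply: (continuous_comp (f := fun r => a + r)); last exact: f_cont.
    by apply: cvgD; [exact: cvg_cst|exact: cvg_id].
  apply: (continuous_comp (f := fun r => x + e - r)); last exact: cont_ph.
  by apply: cvgB; [exact: cvg_cst|exact: cvg_id].
have [r rI E] : exists2 r, r \in `[0, e] & q e - q 0 = dq r * (e - 0).
  apply: MVT_segment => //; last exact: continuous_subspaceT.
  move=> r; rewrite in_itv/= => /andP[r0 re].
  have ar : 0 < a + r < l by apply/andP; split; lra.
  have d1 : is_derive r 1 (fun r => a + r) 1.
    have := is_deriveD (is_derive_cst a r 1) (is_derive_id r 1).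
    by rewrite add0r.
  have d2 : is_derive r 1 (fun r => x + e - r) (- 1).
    have := is_deriveB (is_derive_cst (x + e) r 1) (is_derive_id r 1).
    by rewrite sub0r.
  have h1 := @is_derive1_comp _ f (fun r => a + r) r _ _ (f_der ar) d1.
  have h2 := @is_derive1_comp _ ph (fun r => x + e - r) r _ _ (der_ph _) d2.
  have := is_deriveM h1 h2; rewrite /GRing.scale/=.
  have -> // : f (a + r) * (dph (x + e - r) * -1) +
    ph (x + e - r) * (f (a + r) * (dph (g (a + r)) / ph (g (a + r))) * 1) = dq r.
  by rewrite /dq /logder; field; rewrite !gt_eqF.
move: rI; rewrite in_itv/= => /andP[r0 re].
exists (a + r), (x + e - r); split; [apply/andP; split; lra|apply/andP; split; lra|].
move: E; rewrite /q /dq subr0 addr0 addrK subr0 => E.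
by rewrite -opprB E mulrC.
Qed.

Lemma static_bounds : exists Mf Lm lo : R, [/\ 0 <= Mf, 0 <= Lm,
  forall a : R, 0 <= a <= l -> f a <= Mf,
  forall a : R, 0 <= a <= l -> `|logder (g a)| <= Lm &
  forall a : R, 0 <= a <= l -> lo <= g a].
Proof.
have [c1 _ H1] := EVT_max l0 (continuous_subspaceT f_cont).
have cg : {within `[0, l], continuous (fun a => `|logder (g a)|)}.
  move=> a; apply: (@continuous_comp (subspace `[0, l]) R R g
    (fun y => `|logder y|)); first exact: g_cont.
  by apply: cvg_norm; exact: cont_logder.
have [c2 c2I H2] := EVT_max l0 cg.
have [c3 _ H3] := EVT_min l0 g_cont.
exists (Num.max 0 (f c1)), `|logder (g c2)|, (g c3); split => //.
- by rewrite le_max lexx.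
- by move=> a al; rewrite le_max (H1 a) ?orbT ?in_itv.
Qed.

End static.

(** * The stopped grid sum along a path *)

Lemma expRN_lip (R : realType) (s t : R) : 0 <= s -> 0 <= t -> `|expR (- s) - expR (- t)| <= `|s - t|.
Proof.
wlog st : s t / s <= t.
  move=> H s0 t0; have [st|/ltW st] := leP s t; first exact: H.
  by rewrite distrC (distrC s); exact: H.
move=> s0 t0; have ts0 : 0 <= t - s by rewrite subr_ge0.
have /andP[_ H] := oneB_expRN ts0.
rewrite distrC (distrC s) (ger0_norm ts0) ler0_norm ?subr_le0 ?ler_expR ?lerN2//.
have -> : - (expR (- t) - expR (- s)) = expR (- s) * (1 - expR (- (t - s))).
  by rewrite mulrBr mulr1 -expRD opprB; congr (_ - expR _); ring.
rewrite -[leRHS]mul1r; apply: ler_pM => //.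
  by rewrite subr_ge0 expR_le1 oppr_le0.
by rewrite expR_le1 oppr_le0.
Qed.

Lemma Rintegral_near_cst (R : realType) (h : R -> R) (s t c e : R) : s <= t ->
  lebesgue_measure.-integrable `]s, t] (EFin \o h) ->
  (forall u, s < u <= t -> `|h u - c| <= e) ->
  `|\int[lebesgue_measure]_(u in `]s, t]) h u - c * (t - s)| <= e * (t - s).
Proof.
move=> st ih H.
have cI (y : R) : lebesgue_measure.-integrable `]s, t] (EFin \o cst y).
  have itf : lebesgue_measure.-integrable `[s, t] (EFin \o cst y).
    apply: continuous_compact_integrable; first exact: segment_compact.
    by apply: continuous_subspaceT => u; exact: cvg_cst.
  by apply: integrableS itf => //; apply: subset_itvr; rewrite bnd_simp.
have lm : fine (lebesgue_measure (`]s, t]%classic : set R)) = t - s.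
  rewrite lebesgue_measure_itv/= lte_fin; case: ltP => //= ts.
  by apply/esym/eqP; rewrite subr_eq0 eq_le ts.
have Ic (y : R) : \int[lebesgue_measure]_(_ in `]s, t]) y = y * (t - s).
  by rewrite Rintegral_cst// lm.
have lo : (c - e) * (t - s) <= \int[lebesgue_measure]_(u in `]s, t]) h u.
  rewrite -Ic; apply: le_Rintegral => //; first exact: cI.
  move=> u; rewrite /= in_itv/= => su; have := H u su; rewrite ler_distl.
  by move=> /andP[].
have hi : \int[lebesgue_measure]_(u in `]s, t]) h u <= (c + e) * (t - s).
  rewrite -Ic; apply: le_Rintegral => //; first exact: cI.
  move=> u; rewrite /= in_itv/= => su; have := H u su; rewrite ler_distl.
  by move=> /andP[].
move: lo hi; clear; move: (Rintegral _ _ _) => J lo hi.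
by rewrite ler_distl; apply/andP; split; lra.
Qed.

Lemma near_contact_range (R : realFieldType)
    (a0 a1 au a' x1 xu x' z l gm K lo : R) :
  0 <= a0 -> a0 <= au -> au <= a1 -> a1 <= l -> a1 - a0 <= z ->
  `|x1 - xu| <= z -> x1 <= gm -> gm + l <= K -> z <= 1 -> lo <= xu ->
  a0 <= a' -> a' <= a1 -> x1 <= x' -> x' <= x1 + (a1 - a0) ->
  [/\ 0 <= a' <= l, `|a' - au| <= z, lo - 1 <= x' <= K & `|xu - x'| <= 2 * z].
Proof.
rewrite !ler_distl => a00 au0 au1 al az /andP[x1u ux1] xg gK z1 lox a'0 a'1 x'0 x'1.
by split; apply/andP; split; lra.
Qed.

Lemma near_contact_dist (R : realFieldType) (p q r z d : R) :
  `|p - q| < d / 2 -> `|q - r| <= 2 * z -> z < d / 4 -> `|p - r| < d.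
Proof.
rewrite !ltr_distl ler_distl => /andP[h1 h2] /andP[h3 h4] h5.
by apply/andP; split; lra.
Qed.

(** Here x, a and w are the paths of the reflected process, of its regulator and
    of the Brownian motion.  On the grid of mesh T / (n + 1), [euler] is the
    position that the free process would reach in step i with the same Brownian
    increment (an exact transition of that process, in law), and [defect] is
    what then remains to be explained beyond the increment of a. *)
Section grid.
Context {R : realType} (kappa beta sh delta T l gm K : R) (ph f : R -> R).
Implicit Types (x a w : R -> R) (n i : nat).

Definition mesh n : R := T / n.+1%:R.
Definition tick n i : R := i%:R * mesh n.
Definition euler n x w i : R :=
  ou_mean kappa beta (mesh n) (x (tick n i))
  + sh * ou_vol beta (mesh n) * (w (tick n i.+1) - w (tick n i)).
Definition defect n x a w i : R :=
  x (tick n i.+1) - euler n x w i + (a (tick n i.+1) - a (tick n i)).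
Definition within_bounds n x a w i : bool :=
  [&& a (tick n i) <= l, x (tick n i) <= gm & \sum_(k < i) `|defect n x a w k| <= 1].
(** Being alive at i means that all the bounds have held at the times 0, ..., i.
    It is therefore decreasing in i and determined by the past of time i. *)
Fixpoint alive n x a w i : bool :=
  within_bounds n x a w i && (if i is j.+1 then alive n x a w j else true).
Definition weight n x a w i : R :=
  (alive n x a w i)%:R * expR (- (delta * tick n i)) * f (a (tick n i)).
Definition value n x a w i : R := weight n x a w i * ph (x (tick n i)).
Definition predicted n x a w i : R := weight n x a w i *
  (expR (- (delta * mesh n)) * ph (Num.min (euler n x w i) K)).
(** Each term is the change which [value] would undergo in one free step, so that
    it has almost zero mean given the past. *)
Definition gridsum n x a w : R :=
  value n x a w 0 + \sum_(i < n.+1) (predicted n x a w i - value n x a w i).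

Lemma alive_within_bounds n x a w i : alive n x a w i -> within_bounds n x a w i.
Proof. by case: i => [|i] /= /andP[]. Qed.

Lemma alive_pred n x a w i : alive n x a w i.+1 -> alive n x a w i.
Proof. by move=> /= /andP[]. Qed.

Lemma tickS n i : tick n i.+1 = tick n i + mesh n.
Proof. by rewrite /tick -natr1; ring. Qed.

Lemma tick0 n : tick n 0 = 0.
Proof. by rewrite /tick mul0r. Qed.

Lemma tick_last n : tick n n.+1 = T.
Proof. by rewrite /tick /mesh mulrCA divff ?mulr1// pnatr_eq0. Qed.

#[local] Arguments alive : simpl never.

Context (T0 : 0 < T).

Lemma mesh_gt0 n : 0 < mesh n.
Proof. by rewrite divr_gt0// ltr0n. Qed.

Lemma tick_ge0 n i : 0 <= tick n i.
Proof. by rewrite mulr_ge0// ltW// mesh_gt0. Qed.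

Lemma tick_le n i : (i <= n.+1)%N -> tick n i <= T.
Proof. by move=> h; rewrite -(tick_last n) ler_pM2r ?mesh_gt0// ler_nat. Qed.

Let pay n x a w i := f (a (tick n i)) * ph (Num.min (euler n x w i) K).
Let dead n x a w i : R := (alive n x a w i)%:R - (alive n x a w i.+1)%:R.
Let disc n i : R := expR (- (delta * tick n i)).

(** Summation by parts.  The steps at whose end the sum is still alive contribute
    the difference between the predicted and the actual value, and the step in
    which it dies contributes its predicted value. *)
Lemma gridsumE n x a w : gridsum n x a w = value n x a w n.+1
  + \sum_(i < n.+1) disc n i.+1 * ((alive n x a w i.+1)%:R *
      (pay n x a w i - f (a (tick n i.+1)) * ph (x (tick n i.+1))))
  + \sum_(i < n.+1) dead n x a w i * (disc n i.+1 * pay n x a w i).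
Proof.
suff gen N : value n x a w 0
    + \sum_(i < N) (predicted n x a w i - value n x a w i) = value n x a w N
  + \sum_(i < N) disc n i.+1 * ((alive n x a w i.+1)%:R *
      (pay n x a w i - f (a (tick n i.+1)) * ph (x (tick n i.+1))))
  + \sum_(i < N) dead n x a w i * (disc n i.+1 * pay n x a w i) by exact: gen.
elim: N => [|N IH]; first by rewrite !big_ord0 !addr0.
rewrite !big_ord_recr/= [LHS]addrA {}IH.
have e : disc n N.+1 = expR (- (delta * tick n N)) * expR (- (delta * mesh n)).
  by rewrite /disc tickS -expRD; congr expR; ring.
have -> : value n x a w N.+1 = (alive n x a w N.+1)%:R * disc n N.+1
   * f (a (tick n N.+1)) * ph (x (tick n N.+1)) by [].
rewrite /dead /predicted [value _ _ _ _ N]/value /weight /pay e.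
ring.
Qed.

Lemma dead_ge0 n x a w i : 0 <= dead n x a w i.
Proof. 
rewrite /dead; have := @alive_pred n x a w i.
by case: (alive _ _ _ _ _) => [->|_]; rewrite ?subrr// subr0.
Qed.

Lemma sum_dead n x a w N :
  \sum_(i < N) dead n x a w i = (alive n x a w 0)%:R - (alive n x a w N)%:R.
Proof.
elim: N => [|N IH]; first by rewrite big_ord0 subrr.
by rewrite big_ord_recr/= IH /dead; ring.
Qed.

Context (dph g : R -> R).
Context (l0 : 0 <= l) (gmK : gm + l <= K) (delta0 : 0 < delta).
Context (ph_gt0 : forall y : R, 0 < ph y) (dph_ge0 : forall y : R, 0 <= dph y)
  (ler_dph : forall y z : R, y <= z -> dph y <= dph z)
  (der_ph : forall x : R, is_derive x 1 ph (dph x)) (cont_dph : continuous dph).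
Context (g_cont : {within `[0, l], continuous g})
  (g_le : forall a : R, 0 <= a <= l -> g a <= gm).
Context (f_ge0 : forall a : R, 0 <= a <= l -> 0 <= f a) (f_cont : continuous f)
  (f_der : forall a : R, 0 < a < l -> is_derive a 1 f (f a * (dph (g a) / ph (g a)))).

Let L := logder ph dph.
Let le_ph := ler_ph dph_ge0 der_ph.

(** Splits the one-step error into a part due to the increment of a, controlled by
    [step_mvt], and a part due to the defect, controlled by the Lipschitz
    constant of ph below K. *)
Lemma step_estimate (Mf B a0 a1 x1 X' : R) : 
  (forall a : R, 0 <= a <= l -> f a <= Mf) ->
  0 <= a0 -> a0 <= a1 -> a1 <= l -> x1 <= gm -> 
  (forall a' x' : R, a0 <= a' <= a1 -> x1 <= x' <= x1 + (a1 - a0) ->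
     `|f a' * ph x' * (L (g a') - L x')| <= B) ->
  `|f a0 * ph (Num.min X' K) - f a1 * ph x1| <=
    B * (a1 - a0) + Mf * dph K * `|x1 - X' + (a1 - a0)|.
Proof.
move=> fM a00 a01 a1l xg HB.
have e0 : 0 <= a1 - a0 by rewrite subr_ge0.
have [a' [x' [Ha Hx E]]] := step_mvt ph_gt0 der_ph f_cont f_der x1 a00 e0
  (eq_ind_r (fun z => z <= l) a1l (subrKC a0 a1)).
rewrite subrKC in Ha E.
have a0I : 0 <= a0 <= l by rewrite a00 (le_trans a01).
have -> : f a0 * ph (Num.min X' K) - f a1 * ph x1 =
  (f a0 * ph (x1 + (a1 - a0)) - f a1 * ph x1) +
  f a0 * (ph (Num.min X' K) - ph (Num.min (x1 + (a1 - a0)) K)).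
  have xK : x1 + (a1 - a0) <= K.
    apply: le_trans gmK; apply: lerD => //.
    by apply: le_trans a1l; rewrite lerBlDr lerDl.
  by rewrite (min_l xK); ring.
apply: (le_trans (ler_normD _ _)); rewrite E normrN !normrM.
apply: lerD.
  rewrite (ger0_norm e0) mulrC; apply: ler_wpM2r => //.
  by rewrite -!normrM; exact: HB.
rewrite (ger0_norm (f_ge0 a0I)) -mulrA.
apply: ler_pM => //; [exact: f_ge0|exact: fM|].
apply: (le_trans (lip_ph_min K dph_ge0 ler_dph der_ph _ _)).
by rewrite distrC addrAC.
Qed.

Lemma alive_range n x a w i : a 0 = 0 ->
  (forall s t : R, 0 <= s -> s <= t -> t <= T -> a s <= a t) -> (i <= n.+1)%N ->
  alive n x a w i -> 0 <= a (tick n i) <= l.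
Proof.
move=> a00 am iN /alive_within_bounds/and3P[-> _ _]; rewrite andbT -a00.
by apply: am; rewrite ?tick_ge0// tick_le.
Qed.

(** While the sum is alive, the increments of a add up to at most l and the defects
    to at most 1, so that the step estimates can be summed; after it dies nothing
    is added.  The bound does not depend on the path, as required for dominated
    convergence. *)
Lemma gridsum_bounded : exists C : R, forall n x a w, a 0 = 0 ->
  (forall s t : R, 0 <= s -> s <= t -> t <= T -> a s <= a t) ->
  `|gridsum n x a w| <= C.
Proof.
have [Mf [Lm [lo [Mf0 Lm0 fM LM _]]]] := static_bounds l0 ph_gt0 der_ph cont_dph
  g_cont f_cont.
have phK0 := ltW (ph_gt0 K).
pose B := Mf * (Lm * ph K + dph K).
have B0 : 0 <= B by rewrite mulr_ge0// addr_ge0// mulr_ge0.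
have MK0 : 0 <= Mf * dph K by rewrite mulr_ge0.
exists (Mf * ph K + (B * l + Mf * dph K * 1) + Mf * ph K) => n x a w a00 am.
have disc01 i : 0 <= disc n i <= 1.
  rewrite expR_ge0 /disc expR_le1 oppr_le0 mulr_ge0// ?tick_ge0// ltW//.
have aI i : (i <= n.+1)%N -> alive n x a w i -> 0 <= a (tick n i) <= l.
  exact: alive_range.
have aS i : (i < n.+1)%N -> a (tick n i) <= a (tick n i.+1).
  move=> iN; apply: am; rewrite ?tick_ge0 ?tick_le//.
  by rewrite tickS lerDl ltW// mesh_gt0.
have gmK' : gm <= K by apply: le_trans gmK; rewrite lerDl.
rewrite gridsumE; apply: (le_trans (ler_normD _ _)); apply: lerD.
  apply: (le_trans (ler_normD _ _)); apply: lerD.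
    rewrite /value /weight.
    case: (alive _ _ _ _ _) (aI n.+1 (leqnn _)) (@alive_within_bounds n x a w n.+1);
      last by move=> _ _; rewrite !mul0r normr0 mulr_ge0.
    move=> /(_ isT) aN /(_ isT)/and3P[_ xN _]; rewrite mul1r.
    have /andP[d0 d1] := disc01 n.+1.
    rewrite ger0_norm; last by rewrite mulr_ge0 ?(ltW (ph_gt0 _))// mulr_ge0// f_ge0.
    apply: ler_pM; rewrite ?(ltW (ph_gt0 _))//.
    - by rewrite mulr_ge0// f_ge0.
    - by rewrite -[leRHS]mul1r ler_pM ?f_ge0 ?fM.
    - by apply: le_ph; exact: le_trans gmK'.
  pose al i : R := (alive n x a w i)%:R.
  apply: (@le_trans _ _ (\sum_(i < n.+1) (B * (al i.+1 * (a (tick n i.+1) - a (tick n i)))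
      + Mf * dph K * (al i.+1 * `|defect n x a w i|)))).
    apply: (le_trans (ler_norm_sum _ _ _)); apply: ler_sum => i _.
    have /andP[d0 d1] := disc01 i.+1.
    rewrite normrM (ger0_norm d0) /al.
    case E : (alive n x a w i.+1); last by rewrite !mul0r normr0 !mulr0 addr0.
    rewrite !mul1r; apply: (@le_trans _ _
      `|pay n x a w i - f (a (tick n i.+1)) * ph (x (tick n i.+1))|).
      by rewrite ler_piMl.
    have iN := ltn_ord i.
    have /andP[ai0 ail] := aI i (ltnW iN) (alive_pred E).
    have /and3P[ai1 xi1 _] := alive_within_bounds E.
    rewrite /pay /defect; apply: (step_estimate _ fM) => //; first exact: aS.
    move=> a' x' /andP[a'1 a'2] /andP[x'1 x'2].
    have a'I : 0 <= a' <= l by apply/andP; split; lra.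
    have x'K : x' <= K by have := gmK; lra.
    have p0 := ltW (ph_gt0 x').
    rewrite -mulrA normrM (ger0_norm (f_ge0 a'I)) /B.
    apply: ler_pM => //; [exact: f_ge0|exact: fM|].
    have -> : ph x' * (L (g a') - L x') = L (g a') * ph x' - dph x'.
      by rewrite /L /logder; field; rewrite !gt_eqF.
    apply: (le_trans (ler_normB _ _)); rewrite normrM (ger0_norm p0).
    rewrite (ger0_norm (dph_ge0 _)); apply: lerD; last exact: ler_dph.
    by apply: ler_pM => //; [exact: LM|exact: le_ph].
  rewrite big_split/= -!mulr_sumr; apply: lerD; apply: ler_wpM2l => //.
    rewrite /al; apply: (@sum_stopped_increments _ (alive n x a w)
      (fun i => a (tick n i))) => //; first by rewrite tick0 a00.
    by move=> i iN /alive_within_bounds/and3P[].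
  have -> : \sum_(i < n.+1) al i.+1 * `|defect n x a w i| = \sum_(i < n.+1)
     al i.+1 * (\sum_(k < i.+1) `|defect n x a w k| - \sum_(k < i) `|defect n x a w k|).
    by apply: eq_bigr => i _; rewrite [in RHS]big_ord_recr/= addrAC subrr add0r.
  apply: (@sum_stopped_increments _ (alive n x a w)
      (fun i => \sum_(k < i) `|defect n x a w k|)) => //.
  - by rewrite big_ord0.
  - by move=> i iN; rewrite big_ord_recr/= lerDl.
  - by move=> i iN /alive_within_bounds/and3P[].
apply: (@le_trans _ _ (\sum_(i < n.+1) dead n x a w i * (Mf * ph K))).
  apply: (le_trans (ler_norm_sum _ _ _)); apply: ler_sum => i _.
  rewrite normrM (ger0_norm (dead_ge0 _ _ _ _ _)).
  case E : (alive n x a w i); last first.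
    have /negbTE E' := contraFN (@alive_pred n x a w i) E.
    by rewrite /dead E E' subrr !mul0r.
  apply: ler_wpM2l; first exact: dead_ge0.
  have iN := ltn_ord i.
  have aiI := aI i (ltnW iN) E.
  have /andP[d0 d1] := disc01 i.+1.
  have p0 := ltW (ph_gt0 (Num.min (euler n x w i) K)).
  rewrite /pay ger0_norm; last by rewrite !mulr_ge0// f_ge0.
  rewrite -[leRHS]mul1r; apply: ler_pM => //; first by rewrite mulr_ge0 ?f_ge0.
  apply: ler_pM => //; [exact: f_ge0|exact: fM|].
  by apply: le_ph; rewrite ge_min lexx orbT.
rewrite -mulr_suml -[leRHS]mul1r ler_wpM2r ?mulr_ge0//.
rewrite (sum_dead n x a w n.+1); case: (alive _ _ _ _ 0) (alive _ _ _ _ n.+1) => [] [];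
  rewrite ?subrr ?subr0 ?sub0r//.
Qed.

Context (beta0 : 0 < beta) (sh0 : 0 < sh).

Section path.
Context (x a w : R -> R) (tau : R).
Context (cx : {within `[0, T], continuous x}) (ca : {within `[0, T], continuous a})
  (cw : {within `[0, T], continuous w}).
Context (a00 : a 0 = 0) (am : forall s t : R, 0 <= s -> s <= t -> t <= T -> a s <= a t).
Context (below : forall t : R, 0 <= t <= T -> a t <= l -> x t <= g (a t)).
Context (dyn : forall t : R, 0 <= t <= T -> a t <= l -> x t = x 0
   + \int[lebesgue_measure]_(s in `[0, t]) (kappa - beta * x s) + sh * w t - a t).
Context (contact : forall s t : R, 0 <= s -> s <= t -> t <= T -> a t <= l -> a s < a t ->
   exists2 u, s <= u <= t & x u = g (a u)).
Context (tauP : l < a T -> [/\ 0 <= tau <= T, a tau = l, x tau = g l &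
   forall t : R, tau < t -> t <= T -> l < a t]).

Lemma drift_integrable (t : R) : 0 <= t -> t <= T ->
  lebesgue_measure.-integrable `[0, t] (EFin \o (fun u => kappa - beta * x u)).
Proof.
move=> t0 tT; apply: continuous_compact_integrable; first exact: segment_compact.
have : {within `[0, T], continuous (fun u => kappa - beta * x u)}.
  move=> u; apply: (@continuous_comp (subspace `[0, T]) R R x
    (fun y => kappa - beta * y)); first exact: cx.
  apply: cvgB; first exact: cvg_cst.
  by apply: cvgM; [exact: cvg_cst|exact: cvg_id].
by apply: continuous_subspaceW; apply: subset_itvl; rewrite bnd_simp.
Qed.

Lemma increment (s t : R) : 0 <= s -> s <= t -> t <= T -> a t <= l ->
  x t - x s = \int[lebesgue_measure]_(u in `]s, t]) (kappa - beta * x u)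
    + sh * (w t - w s) - (a t - a s).
Proof.
move=> s0 st tT atl.
have asl : a s <= l by apply: le_trans atl; exact: am.
have t0 := le_trans s0 st.
rewrite (dyn _ atl) ?t0// (dyn _ asl) ?s0 ?(le_trans st)//.
have := @Rintegral_itvB _ _ (BLeft 0) (BRight t) s (drift_integrable t0 tT).
by rewrite !bnd_simp => /(_ s0 st) <-; ring.
Qed.

Let osc n (z : R) := forall u v : R, 0 <= u <= T -> 0 <= v <= T -> `|u - v| <= mesh n ->
  [/\ `|x u - x v| <= z, `|a u - a v| <= z & `|w u - w v| <= z].

Lemma near_osc (z : R) : 0 < z -> \forall n \near \oo, mesh n <= z /\ osc n z.
Proof.
move=> z0.
have [d1 d10 H1] := uniform_continuity_itv cx z0.
have [d2 d20 H2] := uniform_continuity_itv ca z0.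
have [d3 d30 H3] := uniform_continuity_itv cw z0.
pose d := Num.min z (Num.min d1 (Num.min d2 d3)).
have d0 : 0 < d by rewrite !lt_min z0 d10 d20 d30.
exists (Num.truncn (T / d)) => // n /= nN.
have md : mesh n < d.
  rewrite /mesh ltr_pdivrMr ?ltr0n// -ltr_pdivrMl// mulrC.
  by apply: (lt_le_trans (truncnS_gt _)); rewrite ler_nat ltnS.
move: md; rewrite !lt_min => /and4P[mz m1 m2 m3].
split=> [|u v uT vT uv]; first exact: ltW.
by split; apply: ltW; [apply: H1|apply: H2|apply: H3] => //; exact: le_lt_trans uv _.
Qed.

(** Over one step the integral of the drift, the free mean and the free volatility
    differ from their first-order expressions by a multiple of the mesh times the
    oscillation z.  Hence the defects are o(mesh) uniformly and their sum is
    o(1). *)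
Lemma defect_small : exists Ce : R, forall n z i, 0 <= z -> mesh n <= z -> osc n z ->
  (i < n.+1)%N -> a (tick n i.+1) <= l ->
  `|defect n x a w i| <= mesh n * (Ce * z).
Proof.
have cM : {within `[0, T], continuous (fun t => `|kappa / beta - x t|)}.
  move=> u; apply: (@continuous_comp (subspace `[0, T]) R R x
    (fun y => `|kappa / beta - y|)); first exact: cx.
  by apply: cvg_norm; apply: cvgB; [exact: cvg_cst|exact: cvg_id].
have [tM _ HM] := EVT_max (ltW T0) cM.
pose Mx := `|kappa / beta - x tM|.
exists (Mx * beta ^+ 2 + beta + 2 * beta * sh) => n z i z0 mz Hosc iN ail.
have m0 := mesh_gt0 n.
have ti0 := tick_ge0 n i.
have tii : tick n i <= tick n i.+1 by rewrite tickS lerDl ltW.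
have tiT : tick n i.+1 <= T by exact: tick_le.
have h1 := increment ti0 tii tiT ail.
have dm : tick n i.+1 - tick n i = mesh n by rewrite tickS; ring.
have tI : 0 <= tick n i <= T by rewrite ti0 (le_trans tii).
have h2 : `|\int[lebesgue_measure]_(u in `]tick n i, tick n i.+1]) (kappa - beta * x u)
    - (kappa - beta * x (tick n i)) * mesh n| <= (beta * z) * mesh n.
  rewrite -dm; apply: Rintegral_near_cst => //.
    have itf := drift_integrable (le_trans ti0 tii) tiT.
    by apply: integrableS itf => //; apply: subset_itv; rewrite bnd_simp.
  move=> u /andP[iu ui].
  have -> : kappa - beta * x u - (kappa - beta * x (tick n i)) =
     beta * (x (tick n i) - x u) by ring.
  rewrite normrM gtr0_norm// ler_pM2l//.
  have [] // := Hosc (tick n i) u tI _ _.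
    by apply/andP; split; [exact: ltW (le_lt_trans ti0 iu)|exact: le_trans tiT].
  by rewrite distrC ger0_norm ?subr_ge0 ?(ltW iu)// -dm lerD2r.
have [_ _ hw] : [/\ `|x (tick n i.+1) - x (tick n i)| <= z,
    `|a (tick n i.+1) - a (tick n i)| <= z & `|w (tick n i.+1) - w (tick n i)| <= z].
  apply: Hosc => //; first by rewrite tiT (le_trans ti0).
  by rewrite dm gtr0_norm.
have bm : 0 <= beta * mesh n by rewrite mulr_ge0// ltW.
have /andP[e1 e2] := oneB_expRN bm.
have /andP[v1 v2] := ou_vol_sq beta0 m0.
have v0 : 0 <= ou_vol beta (mesh n) by exact: sqrtr_ge0.
set v := ou_vol beta (mesh n) in v0 v1 v2.
set dW := w _ - w _ in hw h1.
set I := \int[_]_(_ in _) _ in h1 h2.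
have -> : defect n x a w i = (I - (kappa - beta * x (tick n i)) * mesh n)
  + (kappa / beta - x (tick n i)) * (beta * mesh n - (1 - expR (- (beta * mesh n))))
  + sh * (1 - v) * dW.
  rewrite /defect /euler /ou_mean -/v -/dW mulNr.
  have -> : x (tick n i.+1) = x (tick n i) + I + sh * dW
     - (a (tick n i.+1) - a (tick n i)) by rewrite -addrA -addrA -[LHS](subrKC (x (tick n i))) h1; ring.
  by field; rewrite gt_eqF.
have hx : `|kappa / beta - x (tick n i)| <= Mx by apply: HM; rewrite in_itv.
have p1 : `|(kappa / beta - x (tick n i))
     * (beta * mesh n - (1 - expR (- (beta * mesh n))))| <= Mx * (beta ^+ 2 * (z * mesh n)).
  rewrite normrM; apply: ler_pM => //.
  rewrite ger0_norm ?subr_ge0//.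
  apply: (@le_trans _ _ ((beta * mesh n) ^+ 2)); first by lra.
  rewrite exprMn ler_pM2l ?exprn_gt0// expr2.
  by rewrite ler_pM2r.
have v1' : `|1 - v| <= 2 * beta * mesh n.
  have vle1 : v <= 1 by rewrite -(expr1n _ 2) ler_sqr ?nnegrE// in v2.
  rewrite ger0_norm ?subr_ge0//.
  have : v ^+ 2 <= v by rewrite expr2 ler_piMl.
  lra.
have p2 : `|sh * (1 - v) * dW| <= sh * (2 * beta * mesh n) * z.
  rewrite !normrM (gtr0_norm sh0).
  by apply: ler_pM => //; [rewrite mulr_ge0// ltW|rewrite ler_pM2l].
apply: (le_trans (ler_normD _ _)).
have := ler_normD (I - (kappa - beta * x (tick n i)) * mesh n)
  ((kappa / beta - x (tick n i)) * (beta * mesh n - (1 - expR (- (beta * mesh n))))).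
move: p1 p2 h2.
move: `|_ * _ * dW| `|_ + _| `|_ * (_ - _)| `|I - _| => A1 A2 A3 A4 p1 p2 h2 h3.
have -> : mesh n * ((Mx * beta ^+ 2 + beta + 2 * beta * sh) * z) =
  beta * z * mesh n + Mx * (beta ^+ 2 * (z * mesh n)) + sh * (2 * beta * mesh n) * z.
  by ring.
lra.
Qed.

(** On a fine grid the defects add up to less than 1 and the reflected path stays
    below its boundary, so that the sum dies only when a exceeds l. *)
Lemma alive_small n z Ce i : 0 <= z -> 0 <= Ce ->
  (forall j, (j < n.+1)%N -> a (tick n j.+1) <= l ->
     `|defect n x a w j| <= mesh n * (Ce * z)) -> T * (Ce * z) <= 1 ->
  (i <= n.+1)%N -> alive n x a w i = (a (tick n i) <= l).
Proof.
move=> z0 C0 Hd HT; elim: i => [|i IH] iN.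
  rewrite /alive /within_bounds big_ord0 ler01 tick0 a00 l0 !andbT/=.
  have := below (t := 0); rewrite lexx (ltW T0) a00 => /(_ isT l0) x0.
  by rewrite (le_trans x0)// g_le// lexx l0.
apply/idP/idP => [/alive_within_bounds/and3P[]//|ail].
have ii : a (tick n i) <= a (tick n i.+1).
  by apply: am; rewrite ?tick_ge0 ?tick_le// tickS lerDl ltW// mesh_gt0.
have -> : alive n x a w i.+1 = within_bounds n x a w i.+1 && alive n x a w i by [].
rewrite (IH (ltnW iN)) (le_trans ii ail) andbT /within_bounds ail/=.
have tI : 0 <= tick n i.+1 <= T by rewrite tick_ge0 tick_le.
have aI : 0 <= a (tick n i.+1) by rewrite -a00 am// ?tick_ge0 ?tick_le.
rewrite (le_trans (below tI ail)) ?g_le ?aI//=.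
apply: (@le_trans _ _ (\sum_(k < i.+1) mesh n * (Ce * z))).
  apply: ler_sum => k _; apply: Hd; first exact: leq_trans (ltn_ord k) _.
  apply: le_trans ail; apply: am; rewrite ?tick_ge0 ?tick_le//.
  by rewrite ler_pM2r ?mesh_gt0// ler_nat ltn_ord.
rewrite sumr_const card_ord -mulr_natl mulrA -/(tick n i.+1).
by apply: le_trans HT; rewrite ler_wpM2r ?mulr_ge0// tick_le.
Qed.

(** By [gridsumE] there are three contributions.  The final value converges to the
    first case of the limit or vanishes.  The sum over the living steps tends to
    0: a step in which a increases contains a contact, so that by uniform
    continuity L(g(a')) - L(x') is small in [step_mvt].  If a exceeds l before T,
    exactly one step is the dying one; it contains tau, and its term tends to
    the value at tau. *)
Lemma path_limit : gridsum n x a w @[n --> \oo] -->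
  (if a T <= l then expR (- (delta * T)) * (f (a T) * ph (x T))
   else expR (- (delta * tau)) * (f l * ph (g l))).
Proof.
have [Mf [Lm [lo [Mf0 Lm0 fM LM gmin]]]] := static_bounds l0 ph_gt0 der_ph cont_dph
  g_cont f_cont.
have [Ce0 HCe0] := defect_small.
pose Ce := `|Ce0|.
have Cep : 0 <= Ce by exact: normr_ge0.
have HCe n z i : 0 <= z -> mesh n <= z -> osc n z ->
    (i < n.+1)%N -> a (tick n i.+1) <= l -> `|defect n x a w i| <= mesh n * (Ce * z).
  move=> z0 mz hz iN ail; apply: (le_trans (HCe0 n z i z0 mz hz iN ail)).
  by rewrite ler_pM2l ?mesh_gt0// ler_wpM2r// ler_norm.
have phK0 := ltW (ph_gt0 K).
have MK0 : 0 <= Mf * dph K by rewrite mulr_ge0.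
pose Mx := `|kappa / beta - x tau|.
(* Cx * z bounds the distance to g l of the predicted position in the step
   that contains tau. *)
pose Cx := beta * (Mx + 1) + 1 + sh.
have Mx0 : 0 <= Mx by exact: normr_ge0.
have Cx0 : 0 <= Cx.
  have b0' := ltW beta0; have s0' := ltW sh0.
  by rewrite /Cx !addr_ge0// mulr_ge0// addr_ge0.
pose Ctot := Mf * ph K * l + Mf * dph K * (T * Ce) +
  (delta * (Mf * ph K) + ph K + Mf * (dph K * Cx)) + 1.
have Ctot0 : 0 < Ctot.
  have T0' := ltW T0; have d0' := ltW delta0; have dK := dph_ge0 K.
  by rewrite ltr_wpDl// !addr_ge0// ?mulr_ge0// ?mulr_ge0.
apply/cvgrPdist_le => e e0.
have [eta [eta0 eta1 eC]] : exists eta, [/\ 0 < eta, eta <= 1 & Ctot * eta <= e].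
  exists (Num.min 1 (e / Ctot)); split.
  - by rewrite lt_min ltr01 divr_gt0.
  - by rewrite ge_min lexx.
  - by rewrite mulrC -ler_pdivlMr// ge_min lexx orbT.
have [dL dL0 HL] := uniform_continuity_itv
  (continuous_subspaceT (cont_logder ph_gt0 der_ph cont_dph) : {within `[lo - 1, K], continuous L}) eta0.
have [dg dg0 Hg] := uniform_continuity_itv g_cont (divr_gt0 dL0 (ltr0n R 2)).
have [df df0 Hf] := uniform_continuity_itv
  (continuous_subspaceT f_cont : {within `[0, l], continuous f}) eta0.
(* The oscillation allowed within a cell must be small for the moduli of L, g
   and f, and such that the defects add up to at most 1. *)
pose z2 := Num.min eta (Num.min (dL / 4) (Num.min dg (Num.min df (T * Ce + 1)^-1))).
have TC0 : 0 <= T * Ce by rewrite mulr_ge0// ltW.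
have z20 : 0 < z2.
  by rewrite !lt_min eta0 divr_gt0//= dg0 df0 invr_gt0 ltr_wpDl.
pose z := z2 / 2.
have z0 : 0 < z by rewrite divr_gt0.
have zz2 : z < z2 by rewrite ltr_pdivrMr// ltr_pMr// ltr1n.
have [ze zL zg zf zT] : [/\ z < eta, z < dL / 4, z < dg, z < df & z < (T * Ce + 1)^-1].
  by move: zz2; rewrite !lt_min => /and5P[].
have z1 : z <= 1 := le_trans (ltW ze) eta1.
near=> n.
have [mz Ho] : mesh n <= z /\ osc n z by near: n; exact: near_osc.
have m0 := mesh_gt0 n.
have zT1 : T * (Ce * z) <= 1.
  rewrite mulrA; apply: (@le_trans _ _ (T * Ce * (T * Ce + 1)^-1)).
    by rewrite ler_wpM2l// ltW.
  by rewrite ler_pdivrMr ?mul1r ?lerDl// ltr_wpDl.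
have Hd j : (j < n.+1)%N -> a (tick n j.+1) <= l ->
    `|defect n x a w j| <= mesh n * (Ce * z).
  by move=> jN ajl; apply: HCe => //; exact: ltW.
have alE i : (i <= n.+1)%N -> alive n x a w i = (a (tick n i) <= l).
  exact: (alive_small (ltW z0) Cep Hd zT1).
have a_ge0 t : 0 <= t -> t <= T -> 0 <= a t by move=> t0 tT; rewrite -a00 am.
have disc01 i : 0 <= disc n i <= 1.
  by rewrite expR_ge0 /disc expR_le1 oppr_le0 mulr_ge0// ?tick_ge0// ltW.
have tSle i : tick n i <= tick n i.+1 by rewrite tickS lerDl ltW.
have gmK' : gm <= K by apply: le_trans gmK; rewrite lerDl.
rewrite distrC gridsumE.
set Main := \sum_(i < n.+1) disc n i.+1 * _.
set Last := \sum_(i < n.+1) dead n x a w i * _.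
have main_le : `|Main| <= Mf * ph K * eta * l + Mf * dph K * (T * (Ce * eta)).
  pose al i : R := (alive n x a w i)%:R.
  apply: (@le_trans _ _ (\sum_(i < n.+1) ((Mf * ph K * eta) * (al i.+1 * (a (tick n i.+1) - a (tick n i)))
      + Mf * dph K * (mesh n * (Ce * eta))))).
    apply: (le_trans (ler_norm_sum _ _ _)); apply: ler_sum => i _.
    have /andP[d0 d1] := disc01 i.+1.
    have iN := ltn_ord i.
    rewrite normrM (ger0_norm d0) /al.
    case E : (alive n x a w i.+1); last first.
      by rewrite !mul0r normr0 !mulr0 add0r !mulr_ge0// ltW.
    rewrite !mul1r; apply: (@le_trans _ _
      `|pay n x a w i - f (a (tick n i.+1)) * ph (x (tick n i.+1))|).
      by rewrite ler_piMl.
    have ail : a (tick n i.+1) <= l by rewrite -alE.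
    have aS : a (tick n i) <= a (tick n i.+1).
      by apply: am; rewrite ?tick_ge0 ?tick_le.
    have ai0 : 0 <= a (tick n i) by rewrite a_ge0 ?tick_ge0// tick_le// ltnW.
    have xig : x (tick n i.+1) <= gm by have /and3P[] := alive_within_bounds E.
    have := Hd i iN ail; rewrite /defect => Hdi.
    (* If a is constant over the step, its increment annihilates any bound B;
       otherwise there is a contact u, and g a' and x' are both close to x u. *)
    have : exists2 B, B * (a (tick n i.+1) - a (tick n i)) <=
        Mf * ph K * eta * (a (tick n i.+1) - a (tick n i)) &
      forall a' x' : R, a (tick n i) <= a' <= a (tick n i.+1) ->
        x (tick n i.+1) <= x' <= x (tick n i.+1) + (a (tick n i.+1) - a (tick n i)) ->
        `|f a' * ph x' * (L (g a') - L x')| <= B.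
      have [aE|aN] := eqVneq (a (tick n i)) (a (tick n i.+1)).
        exists `|f (a (tick n i)) * ph (x (tick n i.+1)) *
          (L (g (a (tick n i))) - L (x (tick n i.+1)))|.
          by rewrite aE subrr !mulr0.
        move=> a' x'; rewrite -aE subrr addr0 => /le_anti <- /le_anti <-.
        by [].
      exists (Mf * ph K * eta) => // a' x' /andP[a'1 a'2] /andP[x'1 x'2].
      have alt : a (tick n i) < a (tick n i.+1) by rewrite lt_neqAle aN.
      have [u /andP[u1 u2] xu] := contact (tick_ge0 n i) (tSle i) (tick_le iN) ail alt.
      have uI : 0 <= u <= T.
        by rewrite (le_trans (tick_ge0 n i) u1) (le_trans u2)// tick_le.
      have tI : 0 <= tick n i <= T by rewrite tick_ge0 tick_le// ltnW.
      have tI1 : 0 <= tick n i.+1 <= T by rewrite tick_ge0 tick_le.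
      have [_ oa _] : [/\ `|x (tick n i.+1) - x (tick n i)| <= z,
         `|a (tick n i.+1) - a (tick n i)| <= z & `|w (tick n i.+1) - w (tick n i)| <= z].
        by apply: Ho => //; rewrite tickS addrAC subrr add0r ger0_norm// ltW.
      rewrite ger0_norm ?subr_ge0// in oa.
      have [ox _ _] : [/\ `|x (tick n i.+1) - x u| <= z,
         `|a (tick n i.+1) - a u| <= z & `|w (tick n i.+1) - w u| <= z].
        apply: Ho => //; rewrite ger0_norm ?subr_ge0//.
        by rewrite tickS lerBlDr (addrC (mesh n)) lerD2r.
      have au1 : a (tick n i) <= a u by apply: am => //; [exact: tick_ge0|case/andP: uI].
      have au2 : a u <= a (tick n i.+1) by apply: am => //; [case/andP: uI|exact: tick_le].
      have auI : 0 <= a u <= l.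
        by rewrite (le_trans ai0 au1) (le_trans au2 ail).
      have gu : lo <= x u by rewrite xu; exact: gmin.
      have [a'I a'u /andP[lox' x'K] ux'] := near_contact_range ai0 au1 au2 ail oa ox
        xig gmK z1 gu a'1 a'2 x'1 x'2.
      have gg : `|g a' - x u| < dL / 2.
        by rewrite xu; apply: Hg; rewrite ?in_itv//=; exact: le_lt_trans zg.
      have LL : `|L (g a') - L x'| < eta.
        apply: HL; rewrite ?in_itv/=; last exact: near_contact_dist gg ux' zL.
        - have ga' := gmin _ a'I.
          rewrite (le_trans (g_le a'I))// andbT.
          by rewrite lerBlDr (le_trans ga')// lerDl.
        - by rewrite lox' x'K.
      rewrite !normrM (ger0_norm (f_ge0 a'I)) (gtr0_norm (ph_gt0 _)).
      apply: ler_pM => //; last exact: ltW.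
        by rewrite mulr_ge0 ?f_ge0 ?(ltW (ph_gt0 _)).
      apply: ler_pM => //; [exact: f_ge0|exact: (ltW (ph_gt0 _))|exact: fM|exact: le_ph].
    move=> [B HB1 HB2].
    apply: (le_trans (step_estimate _ fM ai0 aS ail xig HB2)).
    apply: lerD => //; apply: ler_wpM2l => //; apply: (le_trans Hdi).
    by rewrite ler_pM2l// ler_wpM2l// ltW.
  rewrite big_split/= -mulr_sumr; apply: lerD.
    apply: ler_wpM2l; first by rewrite !mulr_ge0// ltW.
    rewrite /al; apply: (@sum_stopped_increments _ (alive n x a w)
      (fun i => a (tick n i))) => //; first by rewrite tick0 a00.
      by move=> i iN; apply: am; rewrite ?tick_ge0 ?tick_le.
    by move=> i iN /alive_within_bounds/and3P[].
  rewrite sumr_const card_ord -mulr_natl mulrCA; apply: ler_wpM2l => //.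
  by rewrite mulrA -/(tick n n.+1) tick_last.
have alT : alive n x a w n.+1 = (a T <= l) by rewrite alE// tick_last.
have al0 : alive n x a w 0 by rewrite alE// tick0 a00.
case: ifPn => aTl.
  have -> : value n x a w n.+1 = expR (- (delta * T)) * (f (a T) * ph (x T)).
    by rewrite /value /weight alT aTl tick_last mul1r mulrA.
  have -> : Last = 0.
    apply: big1 => i _; have iN := ltn_ord i.
    rewrite /dead !alE//; last exact: ltnW.
    have mT j : (j <= n.+1)%N -> a (tick n j) <= l.
      by move=> jN; apply: le_trans aTl; apply: am; rewrite ?tick_ge0 ?tick_le.
    by rewrite !mT ?subrr ?mul0r// ltnW.
  rewrite addr0 addrAC subrr add0r; apply: (le_trans main_le); apply: le_trans eC.
  have -> : Ctot * eta = Mf * ph K * eta * l + Mf * dph K * (T * (Ce * eta)) +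
    (delta * (Mf * ph K) + ph K + Mf * (dph K * Cx) + 1) * eta by rewrite /Ctot; ring.
  rewrite lerDl; have d0' := ltW delta0; have dK := dph_ge0 K.
  by rewrite mulr_ge0 ?(ltW eta0)// !addr_ge0// ?mulr_ge0// ?mulr_ge0.
have aTl' : l < a T by rewrite ltNge.
have [tauI atau xtau taur] := tauP aTl'.
have -> : value n x a w n.+1 = 0.
  by rewrite /value /weight alT (negbTE aTl) !mul0r.
rewrite add0r.
set Y := expR (- (delta * tau)) * _.
have YE : Y = \sum_(i < n.+1) dead n x a w i * Y.
  by rewrite -mulr_suml (sum_dead n x a w n.+1) al0 alT (negbTE aTl) subr0 mul1r.
have last_le : `|Last - Y| <= (delta * (Mf * ph K) + ph K + Mf * (dph K * Cx)) * eta.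
  rewrite YE -sumrB; apply: (le_trans (ler_norm_sum _ _ _)).
  apply: (@le_trans _ _ (\sum_(i < n.+1) dead n x a w i *
     ((delta * (Mf * ph K) + ph K + Mf * (dph K * Cx)) * eta))); last first.
    rewrite -mulr_suml (sum_dead n x a w n.+1) al0 alT (negbTE aTl) subr0 mul1r.
    exact: lexx.
  apply: ler_sum => i _; have iN := ltn_ord i.
  rewrite -mulrBr normrM (ger0_norm (dead_ge0 _ _ _ _ _)).
  have [ail|nail] := boolP (alive n x a w i); last first.
    have /negbTE E' := contra (@alive_pred n x a w i) nail.
    by rewrite /dead (negbTE nail) E' subrr !mul0r.
  have [ail1|nail1] := boolP (alive n x a w i.+1).
    by rewrite /dead ail ail1 subrr !mul0r.
  apply: ler_wpM2l; first exact: dead_ge0.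
  have ai : a (tick n i) <= l by rewrite -alE// ltnW.
  have ai1 : l < a (tick n i.+1) by rewrite ltNge -alE.
  have tI : 0 <= tick n i <= T by rewrite tick_ge0 tick_le// ltnW.
  have tI1 : 0 <= tick n i.+1 <= T by rewrite tick_ge0 tick_le.
  have [/andP[tau0 tauT] [ti0 tiT]] := (tauI, andP tI).
  have itau : tick n i <= tau.
    by rewrite leNgt; apply/negP => ti; have := taur _ ti tiT; rewrite ltNge ai.
  have taui : tau <= tick n i.+1.
    rewrite leNgt; apply/negP => ti.
    by have := am (tick_ge0 n i.+1) (ltW ti) tauT; rewrite atau leNgt ai1.
  have [ox oa _] : [/\ `|x (tick n i) - x tau| <= z, `|a (tick n i) - a tau| <= z &
      `|w (tick n i) - w tau| <= z].
    apply: Ho => //; rewrite distrC ger0_norm ?subr_ge0//.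
    by rewrite lerBlDr addrC -tickS.
  have [_ _ ow] : [/\ `|x (tick n i.+1) - x (tick n i)| <= z,
      `|a (tick n i.+1) - a (tick n i)| <= z & `|w (tick n i.+1) - w (tick n i)| <= z].
    by apply: Ho => //; rewrite tickS addrAC subrr add0r ger0_norm// ltW.
  have aI : 0 <= a (tick n i) <= l by rewrite a_ge0.
  have lI : 0 <= l <= l by rewrite l0 lexx.
  have fi : `|f (a (tick n i)) - f l| <= eta.
    apply: ltW; apply: Hf; rewrite ?in_itv//=; rewrite -atau.
    exact: le_lt_trans zf.
  have ti : `|tick n i.+1 - tau| <= z.
    rewrite ger0_norm ?subr_ge0//; apply: le_trans mz.
    by rewrite tickS lerBlDr (addrC (mesh n)) lerD2r.
  have ex : `|euler n x w i - g l| <= Cx * z.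
    rewrite -xtau; have bm : 0 <= beta * mesh n by rewrite mulr_ge0// ltW.
    have /andP[_ e2] := oneB_expRN bm.
    have /andP[_ v2] := ou_vol_sq beta0 m0.
    have v0 : 0 <= ou_vol beta (mesh n) by exact: sqrtr_ge0.
    have v1 : ou_vol beta (mesh n) <= 1 by rewrite -(expr1n _ 2) ler_sqr ?nnegrE// in v2.
    have -> : euler n x w i - x tau =
      (1 - expR (- (beta * mesh n))) * (kappa / beta - x (tick n i))
      + (x (tick n i) - x tau) + sh * ou_vol beta (mesh n) * (w (tick n i.+1) - w (tick n i)).
      by rewrite /euler /ou_mean mulNr; ring.
    have -> : Cx * z = beta * z * (Mx + 1) + z + sh * 1 * z by rewrite /Cx; ring.
    apply: (le_trans (ler_normD _ _)); apply: lerD; last first.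
      rewrite !normrM (gtr0_norm sh0) (ger0_norm v0).
      by apply: ler_pM => //; [rewrite mulr_ge0// ltW|rewrite ler_pM2l].
    apply: (le_trans (ler_normD _ _)); apply: lerD => //.
    rewrite normrM; apply: ler_pM => //.
      rewrite ger0_norm ?subr_ge0 ?expR_le1 ?oppr_le0//.
      by apply: (le_trans e2); rewrite ler_pM2l.
    have -> : kappa / beta - x (tick n i) = (kappa / beta - x tau) - (x (tick n i) - x tau).
      by ring.
    apply: (le_trans (ler_normB _ _)); rewrite lerD2l.
    exact: le_trans z1.
  have pi : `|ph (Num.min (euler n x w i) K) - ph (g l)| <= dph K * (Cx * z).
    have -> : g l = Num.min (g l) K.
      by rewrite (min_l (le_trans (g_le lI) gmK')).
    apply: (le_trans (lip_ph_min K dph_ge0 ler_dph der_ph _ _)).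
    by rewrite ler_wpM2l.
  have ei : `|disc n i.+1 - expR (- (delta * tau))| <= delta * z.
    have dt0 : 0 <= delta * tick n i.+1.
      by apply: mulr_ge0; [exact: ltW|exact: tick_ge0].
    have dtau0 : 0 <= delta * tau by apply: mulr_ge0 => //; exact: ltW.
    apply: (le_trans (expRN_lip dt0 dtau0)).
    by rewrite -mulrBr normrM (gtr0_norm delta0) ler_pM2l.
  set p := ph (Num.min (euler n x w i) K) in pi *.
  have p0 : 0 <= p by exact/ltW/ph_gt0.
  have pK : p <= ph K by apply: le_ph; rewrite ge_min lexx orbT.
  have -> : disc n i.+1 * pay n x a w i - Y =
      (disc n i.+1 - expR (- (delta * tau))) * (f (a (tick n i)) * p)
      + expR (- (delta * tau)) * ((f (a (tick n i)) - f l) * p + f l * (p - ph (g l))).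
    by rewrite /pay -/p /Y; ring.
  have fa0 := f_ge0 aI; have fl0 := f_ge0 lI.
  have -> : (delta * (Mf * ph K) + ph K + Mf * (dph K * Cx)) * eta =
    delta * eta * (Mf * ph K) + 1 * (eta * ph K + Mf * (dph K * (Cx * eta))) by ring.
  have zle := ltW ze.
  apply: (le_trans (ler_normD _ _)); apply: lerD; rewrite normrM; apply: ler_pM => //.
  - by apply: (le_trans ei); rewrite ler_pM2l.
  - by rewrite normrM !ger0_norm// ler_pM// fM.
  - by rewrite ger0_norm ?expR_ge0// expR_le1 oppr_le0 mulr_ge0// ltW.
  - apply: (le_trans (ler_normD _ _)); apply: lerD; rewrite normrM; apply: ler_pM => //.
    + by rewrite ger0_norm.
    + by rewrite ger0_norm// fM.
    + apply: (le_trans pi); rewrite ler_wpM2l// ler_wpM2l//.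
apply: (@le_trans _ _ (`|Main| + `|Last - Y|)).
  by rewrite -addrA; exact: ler_normD.
apply: le_trans eC; apply: (@le_trans _ _ (Mf * ph K * eta * l + Mf * dph K * (T * (Ce * eta))
  + (delta * (Mf * ph K) + ph K + Mf * (dph K * Cx)) * eta)); first exact: lerD.
have -> : Ctot * eta = Mf * ph K * eta * l + Mf * dph K * (T * (Ce * eta)) +
    (delta * (Mf * ph K) + ph K + Mf * (dph K * Cx)) * eta + eta by rewrite /Ctot; ring.
by rewrite lerDl ltW.
Unshelve. all: by end_near.
Qed.

End path.
End grid.

(** * The grid sum in the mean *)

Section freezing.
Context d (Omega : measurableType d) (R : realType) (P : probability Omega R).
Context d' (T' : measurableType d') (V : Omega -> T') (D : Omega -> measurableTypeR R) (s : R).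
Context (mV : measurable_fun setT V) (mD : measurable_fun setT D).
Context (lawD : forall U : set (measurableTypeR R), measurable U -> P (D @^-1` U) = normal_prob 0 s U).
Context (indep : forall (B : set T') (U : set (measurableTypeR R)), measurable B -> measurable U ->
  P ((V @^-1` B) `&` (D @^-1` U)) = (P (V @^-1` B) * P (D @^-1` U))%E).

(** The joint law of an independent pair is the product of the laws, so that
    Tonelli's theorem allows V to be frozen while integrating over D. *)
Lemma freezing (H : T' * measurableTypeR R -> \bar R) :
  measurable_fun setT H -> (forall p, 0 <= H p)%E ->
  (\int[P]_w H (V w, D w) = \int[P]_w \int[normal_prob 0 s]_z H (V w, z))%E.
Proof.
move=> mH H0.
pose X : {RV P >-> T'} := HB.pack V (isMeasurableFun.Build _ _ _ _ _ mV).
have mVD : measurable_fun setT (fun w => (V w, D w)) by exact: measurable_fun_pair.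
have [nu nuE] := image_measure P mVD.
have joint A : measurable A -> (distribution P X \x normal_prob 0 s)%E A = nu A.
  move: A; apply: (@product_measure_unique _ _ T' (measurableTypeR R) R (distribution P X) (normal_prob 0 s) nu) => B U mB mU.
  by rewrite nuE /= -lawD// -indep.
transitivity (\int[nu]_p H p)%E.
  rewrite -[LHS]/(\int[P]_(w in (fun w => (V w, D w)) @^-1` setT) (H \o (fun w => (V w, D w))) w)%E.
  rewrite -ge0_integral_pushforward//.
  by apply: eq_measure_integral => A mA _; rewrite nuE.
transitivity (\int[(distribution P X \x normal_prob 0 s)%E]_p H p)%E.
  by apply: eq_measure_integral => A mA _; exact/esym/joint.
rewrite fubini_tonelli1//.
rewrite ge0_integral_distribution//; first exact: measurable_fun_fubini_tonelli_F.
by move=> x; apply: integral_ge0.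
Qed.

End freezing.

Lemma bounded_integrable d (Omega : measurableType d) (R : realType)
    (P : probability Omega R) (Z : Omega -> R) (c : R) :
  measurable_fun setT Z -> (forall w, `|Z w| <= c) ->
  P.-integrable setT (EFin \o Z).
Proof.
move=> mZ Zc; apply: measurable_bounded_integrable; [exact: measurableT| |exact: mZ|].
  by rewrite /= probability_setT ltry.
exists c; split; first exact: num_real.
by move=> y cy w _; apply: le_trans (Zc w) (ltW cy).
Qed.

Lemma le_Rintegral_norm d (Omega : measurableType d) (R : realType)
    (P : probability Omega R) (Z : Omega -> R) (c : R) :
  measurable_fun setT Z -> (forall w, `|Z w| <= c) ->
  `|\int[P]_w Z w| <= c.
Proof.
move=> mZ Zc.
have iZ := bounded_integrable P mZ Zc.
apply: (le_trans (le_normr_Rintegral _ iZ)) => //.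
have -> : c = \int[P]_(w in setT) c.
  by rewrite Rintegral_cst// [X in fine X]probability_setT mulr1.
apply: le_Rintegral => //.
- by apply: (@bounded_integrable _ _ _ _ _ c);
    [exact: measurableT_comp|move=> w; rewrite normr_id].
- by apply: (@bounded_integrable _ _ _ _ _ `|c|).
Qed.

Section onestep.
Context d (Omega : measurableType d) (R : realType) (P : probability Omega R).
Context (F : R -> set (set Omega)) (X A B : R -> Omega -> R).
Context (usual : usual_filtration P F) (bm : brownian_motion P F B)
  (aX : adapted F X) (aA : adapted F A).
Context (kappa beta sh delta T l gm K : R) (ph f : R -> R).
Context (T0 : 0 < T) (delta0 : 0 <= delta).
Context (ph_ge0 : forall y, 0 <= ph y) (mph : measurable_fun setT ph)
  (ler_ph : forall x y, x <= y -> ph x <= ph y) (gmK : gm <= K)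
  (f_ge0 : forall a, 0 <= f a) (mf : measurable_fun setT f) (Mf : R)
  (f_le : forall a, f a <= Mf).
Context (C : R) (C0 : 0 <= C).
Context (step : forall n x, x <= gm ->
  forall h, h = T / n.+1%:R ->
    `|expR (- (delta * h)) * \int[normal_prob 0 (Num.sqrt h)]_z
         ph (Num.min (ou_mean kappa beta h x + sh * ou_vol beta h * z) K) - ph x|
    <= C / n.+1%:R ^+ 2).

(** Measurability with respect to F t is expressed on the type carrying the
    sigma-algebra generated by F t; under [usual_filtration] it generates nothing
    more ([filtration_measurable]). *)
Lemma measurable_adapted (Y : R -> Omega -> R) (s t : R) : adapted F Y ->
  0 <= s -> s <= t -> measurable_fun setT (Y s : g_sigma_algebraType (F t) -> R).
Proof.
move=> aY s0 st _ U mU; rewrite setTI; apply: sub_sigma_algebra.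
exact: (usual_mono usual s0 st (aY s s0 U mU)).
Qed.

Lemma filtration_measurable (t : R) (E : set Omega) : 0 <= t ->
  measurable (E : set (g_sigma_algebraType (F t))) -> F t E.
Proof.
by move=> t0; rewrite /measurable/= (sigma_algebra_id (usual_sigma usual t0)).
Qed.

Lemma filtration_measurable_fun d' (T' : measurableType d') (t : R) (V : Omega -> T') :
  0 <= t -> measurable_fun setT (V : g_sigma_algebraType (F t) -> T') ->
  measurable_fun setT V.
Proof.
move=> t0 mV _ U mU; rewrite setTI; apply: (usual_sub usual t0).
apply: filtration_measurable => //; rewrite -[X in measurable X]setTI.
exact: mV.
Qed.

Let alv n i (w : Omega) := alive kappa beta sh T l gm n (X^~ w) (A^~ w) (B^~ w) i.
Let wgt n i (w : Omega) := weight kappa beta sh delta T l gm f n (X^~ w) (A^~ w) (B^~ w) i.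
Let val n i (w : Omega) := value kappa beta sh delta T l gm ph f n (X^~ w) (A^~ w) (B^~ w) i.
Let pre n i (w : Omega) := predicted kappa beta sh delta T l gm K ph f n (X^~ w) (A^~ w) (B^~ w) i.
Let t_ n i : R := tick T n i.

Let t_le n i j : (i <= j)%N -> t_ n i <= t_ n j.
Proof. by move=> ij; rewrite ler_wpM2r ?ler_nat// ltW// mesh_gt0. Qed.

Let meas n i j (Y : R -> Omega -> R) : adapted F Y -> (i <= j)%N ->
  measurable_fun setT (Y (t_ n i) : g_sigma_algebraType (F (t_ n j)) -> R).
Proof. by move=> aY ij; apply: measurable_adapted => //; [exact: tick_ge0|exact: t_le]. Qed.

Let measurable_within_bounds n i j : (i <= j)%N ->
  measurable_fun setT ((fun w => within_bounds kappa beta sh T l gm n (X^~ w) (A^~ w) (B^~ w) i)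
    : g_sigma_algebraType (F (t_ n j)) -> bool).
Proof.
move=> ij; have aB := bm_adapted bm.
apply: measurable_and; first by apply: measurable_fun_ler => //; exact: meas.
apply: measurable_and; first by apply: measurable_fun_ler => //; exact: meas.
apply: measurable_fun_ler => //; apply: measurable_sum => k.
have ki : (k.+1 <= j)%N by apply: leq_trans ij; exact: ltn_ord.
apply: measurableT_comp => //; apply: measurable_funD.
  apply: measurable_funB; first exact: meas.
  apply: measurable_funD.
    apply: measurable_funD => //; apply: measurable_funM => //.
    exact: (meas aX (ltnW ki)).
  apply: measurable_funM => //; apply: measurable_funB; first exact: meas.
  exact: (meas aB (ltnW ki)).
apply: measurable_funB; first exact: meas.
exact: (meas aA (ltnW ki)).
Qed.

Lemma measurable_alive n i j : (i <= j)%N ->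
  measurable_fun setT (alv n i : g_sigma_algebraType (F (t_ n j)) -> bool).
Proof.
elim: i => [|i IH] ij.
  by apply: measurable_and; [exact: measurable_within_bounds|exact: measurable_cst].
by apply: measurable_and; [exact: measurable_within_bounds|exact: IH (ltnW ij)].
Qed.

Lemma measurable_weight n i :
  measurable_fun setT (wgt n i : g_sigma_algebraType (F (t_ n i)) -> R).
Proof.
have mA := meas (n := n) aA (leqnn i).
have m2 : measurable_fun setT
   ((fun w => f (A (t_ n i) w)) : g_sigma_algebraType (F (t_ n i)) -> R).
  exact: (measurableT_comp mf mA).
apply: measurable_funM; last exact: m2.
apply: measurable_funM => //.
have nb : measurable_fun setT (fun b : bool => b%:R : R) by [].
have m3 : measurable_fun setT
   ((fun w => (alv n i w)%:R : R) : g_sigma_algebraType (F (t_ n i)) -> R).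
  exact: (measurableT_comp nb (@measurable_alive n i i (leqnn i))).
exact: m3.
Qed.

Let disc1 n i : expR (- (delta * t_ n i)) <= 1.
Proof. by rewrite expR_le1 oppr_le0 mulr_ge0// tick_ge0. Qed.

Lemma weight_ge0 n i w : 0 <= wgt n i w.
Proof. by rewrite !mulr_ge0 ?expR_ge0. Qed.

Lemma weight_le n i w : wgt n i w <= Mf.
Proof.
rewrite /wgt /weight -[leRHS]mul1r.
apply: ler_pM; [by rewrite mulr_ge0 ?expR_ge0|exact: f_ge0| |exact: f_le].
rewrite -[leRHS]mul1r.
apply: ler_pM; [exact: ler0n|exact: expR_ge0| |exact: disc1].
by case: (alive _ _ _ _ _ _ _ _ _ _ _).
Qed.

Let weight0 n i w : gm < X (t_ n i) w -> wgt n i w = 0.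
Proof.
move=> Xgm; rewrite /wgt /weight.
have [/alive_within_bounds/and3P[_ + _]|_] := boolP (alive _ _ _ _ _ _ _ _ _ _ _);
  last by rewrite !mul0r.
by rewrite leNgt Xgm.
Qed.

Let mwgt n i : measurable_fun setT (wgt n i).
Proof.
apply: (@filtration_measurable_fun _ _ (t_ n i) (wgt n i)); first exact: tick_ge0.
exact: measurable_weight.
Qed.

Let measT n i Y : adapted F Y -> measurable_fun setT (Y (t_ n i)).
Proof.
move=> aY; apply: (@filtration_measurable_fun _ _ (t_ n i)); first exact: tick_ge0.
exact: meas.
Qed.

Lemma measurable_value n i : measurable_fun setT (val n i).
Proof.
apply: measurable_funM.
  exact: mwgt.
apply: (measurableT_comp mph).
exact: measT.
Qed.

Lemma value_bounded n i w : `|val n i w| <= Mf * ph K.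
Proof.
have [Xgm|Xgm] := leP (X (t_ n i) w) gm; last first.
  by rewrite /val /value -/(wgt n i w) weight0// mul0r normr0 mulr_ge0//
    (le_trans (f_ge0 0)).
rewrite ger0_norm; last by rewrite mulr_ge0// weight_ge0.
apply: ler_pM => //; [exact: weight_ge0|exact: weight_le|].
by apply: ler_ph; exact: le_trans gmK.
Qed.

Lemma measurable_predicted n i : measurable_fun setT (pre n i).
Proof.
have aB := bm_adapted bm.
apply: measurable_funM.
  exact: mwgt.
apply: measurable_funM => //; apply: (measurableT_comp mph).
apply: measurable_minr => //; apply: measurable_funD.
  apply: measurable_funD => //; apply: measurable_funM => //.
  exact: measT.
apply: measurable_funM => //; apply: measurable_funB.
  exact: measT.
exact: measT.
Qed.

Lemma predicted_bounded n i w : `|pre n i w| <= Mf * (1 * ph K).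
Proof.
rewrite ger0_norm; last by rewrite !mulr_ge0 ?weight_ge0 ?expR_ge0.
apply: ler_pM; [exact: weight_ge0|by rewrite mulr_ge0 ?expR_ge0|exact: weight_le|].
apply: ler_pM => //.
  by rewrite expR_le1 oppr_le0 mulr_ge0// ltW// mesh_gt0.
by apply: ler_ph; rewrite ge_min lexx orbT.
Qed.

(** The weight and X at time t are F t measurable and the Brownian increment is
    independent of them; after freezing them the integral over the increment is
    the one-step integral of the hypothesis [step]. *)
Lemma onestep n i : (i < n.+1)%N ->
  `|\int[P]_w (pre n i w - val n i w)| <= Mf * (C / n.+1%:R ^+ 2).
Proof.
move=> iN.
pose h := mesh T n; have h0 : 0 < h by exact: mesh_gt0.
pose t := t_ n i; pose t' := t_ n i.+1.
have t0 : 0 <= t by exact: tick_ge0.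
have t'E : t' = t + h by exact: tickS.
have tt' : t < t' by rewrite t'E ltrDl.
have aB := bm_adapted bm.
pose u x z := ph (Num.min (ou_mean kappa beta h x + sh * ou_vol beta h * z) K).
pose Psi x := \int[normal_prob 0 (Num.sqrt h)]_z u x z.
have u0 x z : 0 <= u x z by exact: ph_ge0.
have uK x z : `|u x z| <= ph K.
  by rewrite ger0_norm//; apply: ler_ph; rewrite ge_min lexx orbT.
have mu : measurable_fun setT (fun p : R * measurableTypeR R => u p.1 p.2).
  apply: (measurableT_comp mph); apply: measurable_minr => //.
  apply: measurable_funD.
    by apply: measurable_funD => //; exact: measurable_funM.
  by apply: measurable_funM => //; exact: measurable_snd.
have mux x : measurable_fun setT (u x).
  apply: (measurableT_comp mph); apply: measurable_minr => //.
  by apply: measurable_funD => //; exact: measurable_funM.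
have PsiE x : (\int[normal_prob 0 (Num.sqrt h)]_z (u x z)%:E = (Psi x)%:E)%E.
  rewrite fineK//; apply: integrable_fin_num => //.
  exact: (bounded_integrable (normal_prob 0 (Num.sqrt h)) (mux x) (uK x)).
pose V w := (X t w, wgt n i w).
pose D (w : Omega) : measurableTypeR R := incr B t t' w.
have mVF : measurable_fun setT (V : g_sigma_algebraType (F t) -> R * R).
  by apply: measurable_fun_pair; [exact: meas|exact: measurable_weight].
have mV : measurable_fun setT V by apply: (@filtration_measurable_fun _ _ t).
have mD : measurable_fun setT D.
  apply: measurable_funB.
    exact: measT.
  exact: measT.
have tt'h : t' - t = h by rewrite t'E addrAC subrr add0r.
have lawD (U : set (measurableTypeR R)) : measurable U ->
    P (D @^-1` U) = normal_prob 0 (Num.sqrt h) U.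
  by move=> mU; rewrite -tt'h; exact: (bm_normal bm t0 tt').
have indep (E : set (R * R)) (U : set (measurableTypeR R)) :
    measurable E -> measurable U ->
    P ((V @^-1` E) `&` (D @^-1` U)) = (P (V @^-1` E) * P (D @^-1` U))%E.
  move=> mE mU; apply: (bm_indep bm t0 tt') => //.
  apply: filtration_measurable => //; rewrite -[X in measurable X]setTI.
  exact: mVF.
(* The norm makes H nonnegative everywhere, as Tonelli requires; on the range
   of V it changes nothing. *)
pose H (p : (R * R) * measurableTypeR R) : \bar R :=
  (`|p.1.2| * (expR (- (delta * h)) * u p.1.1 p.2))%:E.
have mH : measurable_fun setT H.
  apply/measurable_EFinP; apply: measurable_funM.
    apply: measurableT_comp => //.
    exact: (measurableT_comp measurable_snd measurable_fst).
  apply: measurable_funM => //.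
  apply: (measurableT_comp mu
    (g := fun p : (R * R) * measurableTypeR R => (p.1.1, p.2))).
  apply: measurable_fun_pair; last exact: measurable_snd.
  exact: (measurableT_comp measurable_fst measurable_fst).
have H0 p : (0 <= H p)%E by rewrite lee_fin !mulr_ge0 ?expR_ge0.
have := freezing mV mD lawD indep mH H0.
have innerE w : (\int[normal_prob 0 (Num.sqrt h)]_z H (V w, z) =
    (wgt n i w * (expR (- (delta * h)) * Psi (X t w)))%:E)%E.
  rewrite mulrA EFinM -PsiE -ge0_integralZl//; last 3 first.
  - by apply/measurable_EFinP; exact: mux.
  - by move=> z _; rewrite lee_fin.
  - by rewrite lee_fin mulr_ge0 ?weight_ge0 ?expR_ge0.
  apply: eq_integral => z _; rewrite -EFinM; congr EFin.
  by rewrite /= (ger0_norm (weight_ge0 n i w)) mulrA.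
under [in X in _ = X -> _]eq_integral do rewrite innerE.
pose Q w := wgt n i w * (expR (- (delta * h)) * Psi (X t w)).
move=> frz.
have mQ : measurable_fun setT Q.
  apply/measurable_EFinP.
  rewrite (_ : EFin \o Q = (fun p => \int[normal_prob 0 (Num.sqrt h)]_z H (p, z))%E \o V).
    apply: measurableT_comp => //.
    exact: (measurable_fun_fubini_tonelli_F (m2 := normal_prob 0 (Num.sqrt h)) H mH H0).
  by apply/funext => w /=; rewrite innerE.
have Psi0 x : 0 <= Psi x by apply: Rintegral_ge0.
have PsiK x : Psi x <= ph K.
  apply: le_trans (ler_norm _) _.
  exact: (le_Rintegral_norm (normal_prob 0 (Num.sqrt h)) (mux x) (uK x)).
have Qb w : `|Q w| <= Mf * (1 * ph K).
  rewrite ger0_norm; last by rewrite !mulr_ge0 ?weight_ge0 ?expR_ge0.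
  apply: ler_pM; [exact: weight_ge0|by rewrite mulr_ge0 ?expR_ge0|exact: weight_le|].
  apply: ler_pM => //.
  by rewrite expR_le1 oppr_le0 mulr_ge0// ltW.
have preQ : \int[P]_w pre n i w = \int[P]_w Q w.
  rewrite /Rintegral; congr fine; rewrite -frz; apply: eq_integral => w _.
  rewrite /H /=; congr EFin.
  by rewrite (ger0_norm (weight_ge0 n i w)).
have iv := bounded_integrable P (measurable_value n i) (value_bounded n i).
have ip := bounded_integrable P (measurable_predicted n i) (predicted_bounded n i).
have iQ := bounded_integrable P mQ Qb.
rewrite RintegralB// preQ -RintegralB//.
apply: le_Rintegral_norm; first by apply: measurable_funB => //; exact: measurable_value.
move=> w; have -> : Q w - val n i w =
    wgt n i w * (expR (- (delta * h)) * Psi (X t w) - ph (X t w)).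
  by rewrite /Q /val /value -/(wgt n i w) mulrBr.
have [Xgm|Xgm] := leP (X t w) gm; last first.
  rewrite weight0// mul0r normr0 mulr_ge0 ?divr_ge0 ?sqr_ge0//.
  exact: le_trans (f_ge0 0) (f_le 0).
rewrite normrM (ger0_norm (weight_ge0 n i w)).
apply: ler_pM => //; [exact: weight_ge0|exact: weight_le|].
by apply: step.
Qed.

Let gsum n w := gridsum kappa beta sh delta T l gm K ph f n (X^~ w) (A^~ w) (B^~ w).

Lemma integrable_value n i : P.-integrable setT (EFin \o val n i).
Proof. exact: (bounded_integrable P (measurable_value n i) (value_bounded n i)). Qed.

Let partial n k : (k <= n.+1)%N ->
  P.-integrable setT (EFin \o (fun w => \sum_(i < k) (pre n i w - val n i w))) /\
  `|\int[P]_w \sum_(i < k) (pre n i w - val n i w)| <= k%:R * (Mf * (C / n.+1%:R ^+ 2)).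
Proof.
elim: k => [|k IH] kn.
  split; last first.
    by under eq_Rintegral do rewrite big_ord0; rewrite Rintegral_cst// mul0r normr0 mul0r.
  apply: (@bounded_integrable _ _ _ _ _ 0).
    under eq_fun do rewrite big_ord0. exact: measurable_cst.
  by move=> w; rewrite big_ord0 normr0.
have [IH1 IH2] := IH (ltnW kn).
have i1 : P.-integrable setT (EFin \o (fun w => pre n k w - val n k w)).
  have := integrableB measurableT
   (bounded_integrable P (measurable_predicted n k) (predicted_bounded n k))
   (integrable_value n k).
  by apply: eq_integrable.
have E2 : (fun w => \sum_(i < k.+1) (pre n i w - val n i w)) =
  (fun w => \sum_(i < k) (pre n i w - val n i w) + (pre n k w - val n k w)).
  by apply/funext => w; rewrite big_ord_recr.
split.
  rewrite E2; have := integrableD measurableT IH1 i1.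
  by apply: eq_integrable.
under eq_Rintegral do rewrite big_ord_recr/=.
rewrite RintegralD// -natr1 mulrDl mul1r.
by apply: (le_trans (ler_normD _ _)); apply: lerD => //; exact: onestep.
Qed.

Lemma gridsum_integrable n : P.-integrable setT (EFin \o gsum n).
Proof.
have [I _] := @partial n n.+1 (leqnn _).
by apply: (eq_integrable _ _ _ _ (integrableD measurableT (integrable_value n 0) I)).
Qed.

Lemma gridsum_mean n :
  `|\int[P]_w gsum n w - \int[P]_w val n 0 w| <= Mf * C / n.+1%:R.
Proof.
have [I H] := @partial n n.+1 (leqnn _).
have -> : \int[P]_w gsum n w = \int[P]_w val n 0 w
    + \int[P]_w \sum_(i < n.+1) (pre n i w - val n i w).
  exact: (RintegralD measurableT (integrable_value n 0) I).
rewrite addrAC subrr add0r; apply: (le_trans H).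
have : (0 : R) < n.+1%:R by rewrite ltr0n.
move: (n.+1%:R : R) => m m0.
by rewrite le_eqVlt; apply/orP; left; apply/eqP; field; rewrite gt_eqF.
Qed.

End onestep.

(** * The first passage time of A *)

Section path_of_solution.
Context d (Omega : measurableType d) (R : realType).
Context (X A : R -> Omega -> R) (w : Omega) (theta l : R) (g : R -> R).
Context (cX : continuous_path X w) (cA : continuous_path A w).
Context (mA : forall s t : R, 0 <= s -> s <= t -> A s w <= A t w) (A0 : A 0 w = 0).
Context (l0 : 0 <= l) (ltheta : l < theta).
Context (g_cont : {within `[0, theta], continuous g}).
Context (carried : carried_by_contact g X A (tau theta A theta w) w).

Lemma le_tau (t a : R) : A t w <= a -> a < theta -> (t%:E <= tau theta A a w)%E.
Proof.
move=> At atheta; apply: le_ereal_inf_tmp => _ [s [s0 sA] <-]; rewrite lee_fin leNgt.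
apply/negP => st; have := mA (ltW s0) (ltW st).
move=> h; have {}h := le_trans h At.
by case: sA => E; move: h; rewrite leNgt ?E// atheta.
Qed.

Lemma le_tau_theta (t : R) : A t w < theta -> (t%:E <= tau theta A theta w)%E.
Proof.
move=> At; apply: le_ereal_inf_tmp => _ [s [s0 sA] <-]; rewrite lee_fin leNgt.
apply/negP => st; have := mA (ltW s0) (ltW st); rewrite leNgt => /negP; apply.
by case: sA => [/(lt_trans At)|->].
Qed.

(** If no time in ]s, t] is a contact time, the measure dA restricted to contacts
    gives the same mass to ]0, s] and ]0, t], so that A s = A t. *)
Lemma contact_between (s t : R) : 0 <= s -> s <= t -> A t w < theta -> A s w < A t w ->
  exists2 u, s < u <= t & X u w = g (A u w).
Proof.
move=> s0 st Atheta Ast; apply: contrapT => nocontact.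
have [a aA carr] := carried.
have t0 := le_trans s0 st.
have e1 := carr t t0 (le_tau_theta Atheta).
have e2 := carr s s0 (le_tau_theta (lt_trans Ast Atheta)).
suff : (A t w - A 0 w)%:E = (A s w - A 0 w)%:E.
  by move=> [] /addIr E; move: Ast; rewrite E ltxx.
rewrite e1 e2 [LHS]integral_mkcond [RHS]integral_mkcond; apply: eq_integral => u _.
rewrite !patchE.
case: ifPn; case: ifPn => //; rewrite ?inE ?notin_setE /= !in_itv/=.
  move=> us /andP[u0 ut]; rewrite indicE memNset//= => Xu.
  apply: nocontact; exists u => //; rewrite ut andbT ltNge; apply/negP => us'.
  by apply: us; rewrite u0.
by move=> /andP[u0 us]; rewrite u0 (le_trans us st).
Qed.

Let S := [set t : R | 0 < t /\ (l < A t w \/ A t w = theta)].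

(** As l < theta, the clause A = theta adds no time. *)
Let SE t : S t <-> 0 < t /\ l < A t w.
Proof.
by split=> -[t0]; [case=> [|->]; split|split => //; left].
Qed.

Context (T : R) (T0 : 0 < T) (AT : l < A T w).

Let ST : S T. Proof. by apply/SE. Qed.

Let lbS : has_lbound S. Proof. by exists 0 => t [/ltW]. Qed.

Let tr := inf S.

Lemma tau_fin : tau theta A l w = tr%:E.
Proof. by rewrite /tau ereal_inf_EFin//; exists T. Qed.

Let tr_le t : 0 < t -> l < A t w -> tr <= t.
Proof. by move=> t0 At; apply: ge_inf => //; apply/SE. Qed.

Let tr0 : 0 <= tr.
Proof. by apply: lb_le_inf; [exists T|move=> t [/ltW]]. Qed.

Let trT : tr <= T. Proof. exact: tr_le. Qed.

Let tr_right t : tr < t -> l < A t w.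
Proof.
move=> trt; have : ~ lbound S t.
  move=> lb; have : t <= tr by apply: lb_le_inf => //; exists T.
  by rewrite leNgt trt.
move=> /existsNP[s /not_implyP[/SE[s0 As] /negP]]; rewrite -ltNge => st.
exact: lt_le_trans As (mA (ltW s0) (ltW st)).
Qed.

Let sub1 : `[0, T + 1] `<=` `[0, +oo[%classic.
Proof. by move=> t /=; rewrite !in_itv/= andbT => /andP[]. Qed.

Let ucA := uniform_continuity_itv (continuous_subspaceW sub1 cA).
Let ucX := uniform_continuity_itv (continuous_subspaceW sub1 cX).

Let inI t : 0 <= t -> t <= T + 1 -> t \in `[0, T + 1].
Proof. by move=> t0 tT; rewrite in_itv/= t0. Qed.

Let trI : tr \in `[0, T + 1].
Proof. by apply: inI => //; rewrite (le_trans trT)// lerDl. Qed.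

(** By continuity: A > l just after tr, and A cannot exceed l before tr. *)
Let A_tr : A tr w = l.
Proof.
apply/eqP; rewrite eq_le; apply/andP; split; rewrite leNgt; apply/negP => h.
  have trp : 0 < tr.
    by rewrite lt_neqAle tr0 andbT; apply/eqP => E; move: h; rewrite -E A0 ltNge l0.
  have e0 : 0 < A tr w - l by rewrite subr_gt0.
  have [e ep He] := ucA e0.
  pose s := Num.max (tr / 2) (tr - e / 2).
  have s1 : tr / 2 <= s by rewrite le_max lexx.
  have s2 : tr - e / 2 <= s by rewrite le_max lexx orbT.
  have s3 : s < tr by rewrite gt_max; apply/andP; split; lra.
  have s0 : 0 < s by lra.
  have := He tr s trI; rewrite inI ?(ltW s0)//; last by rewrite (le_trans (ltW s3))// (le_trans trT)// lerDl.
  have -> : `|tr - s| < e by rewrite ger0_norm; lra.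
  move=> /(_ isT isT); rewrite ltr_distl => /andP[_ As].
  have Als : l < A s w by lra.
  by have := tr_le s0 Als; rewrite leNgt s3.
have e0 : 0 < l - A tr w by rewrite subr_gt0.
have [e ep He] := ucA e0.
pose s := tr + Num.min (e / 2) 1.
have m0 : 0 < Num.min (e / 2) 1 by rewrite lt_min ltr01 divr_gt0.
have m1 : Num.min (e / 2) 1 <= 1 by rewrite ge_min lexx orbT.
have m2 : Num.min (e / 2) 1 <= e / 2 by rewrite ge_min lexx.
have s3 : tr < s by rewrite ltrDl.
have := He s tr; rewrite trI inI; [|by rewrite (le_trans tr0)// ltW|by rewrite lerD].
have -> : `|s - tr| < e by rewrite /s addrAC subrr add0r ger0_norm; lra.
move=> /(_ isT isT isT); rewrite ltr_distl => /andP[_ As].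
have Als := tr_right s3.
lra.
Qed.

(** A increases strictly on every interval [tr, tr + m], hence contacts occur at
    times tending to tr, and the equation X = g(A) passes to the limit. *)
Let X_tr : X tr w = g l.
Proof.
apply: contrapT => /eqP; rewrite -subr_eq0 -normr_gt0 => h.
have e0 : 0 < `|X tr w - g l| / 2 by rewrite divr_gt0.
have [dX dX0 HX] := ucX e0.
have [dg dg0 Hg] := uniform_continuity_itv g_cont e0.
have mg : 0 < Num.min dg (theta - l) by rewrite lt_min dg0 subr_gt0.
have [dA dA0 HA] := ucA mg.
pose m := Num.min (Num.min (dX / 2) (dA / 2)) 1.
have m0 : 0 < m by rewrite !lt_min ltr01 !divr_gt0.
have mX : m < dX by rewrite !gt_min ltr_pdivrMr// ltr_pMr// ltr1n.
have mA' : m < dA.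
  by rewrite !gt_min [dA / 2 < _]ltr_pdivrMr// ltr_pMr// ltr1n orbT.
have m1 : m <= 1 by rewrite !ge_min lexx orbT.
have s3 : tr < tr + m by rewrite ltrDl.
have sI : tr + m \in `[0, T + 1].
  by apply: inI; [rewrite addr_ge0// ltW|rewrite lerD].
have := HA (tr + m) tr sI trI; rewrite addrAC subrr add0r (gtr0_norm m0) => /(_ mA').
rewrite A_tr lt_min => /andP[_]; rewrite ltr_distl => /andP[_].
rewrite subrKC => Atheta.
have Als : A tr w < A (tr + m) w by rewrite A_tr; exact: tr_right.
have [u /andP[u1 u2] Xu] := contact_between tr0 (ltW s3) Atheta Als.
have um : `|u - tr| <= m by rewrite gtr0_norm ?subr_gt0// lerBlDl.
have uI : u \in `[0, T + 1].
  apply: inI; first exact: le_trans (ltW u1).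
  by apply: (le_trans u2); move: sI; rewrite in_itv/= => /andP[].
have h1 := HX u tr uI trI (le_lt_trans um mX).
have := HA u tr uI trI (le_lt_trans um mA').
rewrite A_tr lt_min => /andP[Aul _].
have Au0 : l < A u w by exact: tr_right.
have h2 : `|g (A u w) - g l| < `|X tr w - g l| / 2.
  apply: Hg => //; rewrite in_itv/=; last by rewrite l0 ltW.
  rewrite (le_trans l0 (ltW Au0))/= ltW// (le_lt_trans _ Atheta)//.
  by apply: mA => //; exact: le_trans (ltW u1).
have := ler_distD (X u w) (X tr w) (g l).
rewrite leNgt => /negP; apply; rewrite [ltRHS]splitr; apply: ltrD.
  by rewrite distrC.
by rewrite Xu.
Qed.

Lemma tau_contact : [/\ 0 <= tr <= T, A tr w = l, X tr w = g l &
  forall t : R, tr < t -> t <= T -> l < A t w].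
Proof. by split => //; [rewrite tr0 trT|move=> t /tr_right]. Qed.

End path_of_solution.

(** * The factor f and its boundary values *)

Lemma continuous_within_comp (R : realType) (h c : R -> R) (A : set R) :
  {within A, continuous h} -> continuous c -> (forall y, A (c y)) ->
  continuous (h \o c).
Proof.
move=> hA cc Ac y.
have hc : h @ within A (nbhs (c y)) --> h (c y).
  by move/subspace_continuousP : hA; exact.
apply: (@cvg_comp _ _ _ c h (nbhs y) (within A (nbhs (c y)))) hc => U /= AU.
have cAU : nbhs y (fun z => A (c z) -> U (c z)) := cc y _ AU.
suff : nbhs y (fun z => U (c z)) by [].
by apply: filterS cAU => z Uz; apply: Uz.
Qed.

Section boundary.
Context {R : realType} (theta l : R) (b db ph dph : R -> R).
Context (theta0 : 0 < theta) (l0 : 0 <= l) (ltheta : l < theta).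
Context (bC1 : C1_on theta b db).
Context (ph_gt0 : forall x, 0 < ph x) (der_ph : forall x : R, is_derive x 1 ph (dph x))
  (cont_dph : continuous dph).

Let slope_near x e : x \in `[0, theta] -> 0 < e ->
  exists2 r, 0 < r & forall y, y \in `[0, theta] -> y != x -> `|x - y| < r ->
    `|db x - (b y - b x) / (y - x)| < e.
Proof.
move=> xI e0; have /cvgrPdist_lt/(_ e e0) := bC1.1 x xI.
move=> /nbhs_ballP[r /= r0 H]; exists r => // y yI yx xy.
by apply: (H y) => //.
Qed.

Lemma C1_continuous : {within `[0, theta], continuous b}.
Proof.
apply/subspace_continuousP => x /= xI.
have {}xI : x \in `[0, theta] by [].
have [r r0 H] := slope_near xI ltr01.
apply/cvgrPdist_lt => e e0.
pose M := `|db x| + 1.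
have M0 : 0 < M by rewrite ltr_wpDl.
apply/nbhs_ballP; exists (Num.min r (e / M)) => /=.
  by rewrite lt_min r0 divr_gt0.
move=> y; rewrite /ball/= lt_min => /andP[yr ye] yI.
have [->|yx] := eqVneq y x; first by rewrite subrr normr0.
have yx0 : y - x != 0 by rewrite subr_eq0.
have q1 : `|(b y - b x) / (y - x)| < M.
  have := H y yI yx yr; have := ler_distD (db x) ((b y - b x) / (y - x)) 0.
  rewrite !subr0 distrC /M; lra.
have -> : b x - b y = (b y - b x) / (y - x) * (x - y).
  by field.
rewrite normrM (le_lt_trans (ler_wpM2r (normr_ge0 _) (ltW q1)))//.
by rewrite mulrC -ltr_pdivlMr.
Qed.

Lemma C1_is_derive x : 0 < x < theta -> is_derive x 1 b (db x).
Proof.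
move=> /andP[x0 xt].
have xI : x \in `[0, theta] by rewrite in_itv/= !ltW.
apply/is_derive1_caratheodory.
exists (fun z => if z == x then db x else (b z - b x) / (z - x)); split.
- move=> z; case: eqVneq => [->|zx]; first by rewrite !subrr mulr0.
  by rewrite divfK// subr_eq0.
- rewrite /prop_for /continuous_at eqxx; apply/cvgrPdist_lt => e e0.
  have [r r0 H] := slope_near xI e0.
  apply/nbhs_ballP; exists (Num.min r (Num.min x (theta - x))) => /=.
    by rewrite !lt_min r0 x0 subr_gt0.
  move=> y; rewrite /ball/= !lt_min => /and3P[yr yx yt].
  case: eqVneq => [_|yxn]; first by rewrite subrr normr0.
  apply: H => //; move: yx yt; rewrite !ltr_distl in_itv/= => /andP[? ?] /andP[? ?].
  by apply/andP; split; lra.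
- by rewrite eqxx.
Qed.

Let g a := b (theta - a).

Lemma boundary_continuous : {within `[0, theta], continuous g}.
Proof.
have H := C1_continuous.
apply/subspace_continuousP => x /= xI.
apply: (@cvg_comp _ _ _ (fun a => theta - a) b (within `[0, theta] (nbhs x))
    (within `[0, theta] (nbhs (theta - x)))).
  move=> U /= AU.
  have cc : (fun a : R => theta - a) @ x --> theta - x.
    by apply: cvgB; [exact: cvg_cst|exact: cvg_id].
  have cAU : nbhs x (fun z => `[0, theta]%classic (theta - z) -> U (theta - z)).
    exact: cc _ AU.
  suff : nbhs x (fun z => `[0, theta]%classic z -> U (theta - z)) by [].
  apply: filterS cAU => z; rewrite /= !in_itv/= => Uz /andP[? ?].
  by apply: Uz; apply/andP; split; lra.
move/subspace_continuousP : H; apply; move: xI; rewrite /= !in_itv/= => /andP[? ?].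
by apply/andP; split; lra.
Qed.

Let L := logder ph dph.
Let k x := (db x - 1) * L (b x).
Let cL : continuous L := cont_logder ph_gt0 der_ph cont_dph.

Lemma rate_continuous : {within `[0, theta], continuous k}.
Proof.
move=> x; apply: cvgM.
  by apply: cvgB; [exact: bC1.2|exact: cvg_cst].
apply: (@continuous_comp (subspace `[0, theta]) R R b L); last exact: cL.
exact: C1_continuous.
Qed.

Let intk : lebesgue_measure.-integrable `[0, theta] (EFin \o k).
Proof.
apply: continuous_compact_integrable; first exact: segment_compact.
exact: rate_continuous.
Qed.

(** The primitive of the rate k; then f(a) is G(theta - a) with G as below. *)
Let ik x := \int[lebesgue_measure]_(t in `[0, x]) k t.

Let ik_cont : {within `[0, theta], continuous ik}.
Proof. exact: (parameterized_integral_continuous (ltW theta0) intk). Qed.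

Let ik_der x : 0 < x < theta -> is_derive x 1 ik (k x).
Proof.
move=> /andP[x0 xt].
have kx : {for x, continuous k}.
  have /(continuous_within_itvP _ theta0)[+ _ _] := rate_continuous.
  by apply; rewrite in_itv/= x0.
have [h1 h2] := continuous_FTC1_closed xt intk x0 kx.
by split; [exact: h1|rewrite -derive1E; exact: h2].
Qed.

Let G x := expR (ik x - ik theta) / ph (b x).

Let G_cont : {within `[0, theta], continuous G}.
Proof.
move=> x; apply: cvgM.
  apply: (@continuous_comp (subspace `[0, theta]) R R ik (fun y => expR (y - ik theta))).
    exact: ik_cont.
  apply: (continuous_comp (f := fun y => y - ik theta)); last exact: continuous_expR.
  by apply: cvgB; [exact: cvg_id|exact: cvg_cst].
apply: (@continuous_comp (subspace `[0, theta]) R R b (fun y => (ph y)^-1)).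
  exact: C1_continuous.
by apply: cvgV; [rewrite gt_eqF|exact: (cont_ph der_ph)].
Qed.

Let G_der x : 0 < x < theta -> is_derive x 1 G (- (G x * L (b x))).
Proof.
move=> xI.
have d1 : is_derive x 1 (fun y => ik y - ik theta) (k x).
  have := is_deriveB (ik_der xI) (is_derive_cst (ik theta) x 1).
  by rewrite subr0.
have d2 := @is_derive1_comp _ expR (fun y => ik y - ik theta) x _ _ (is_derive_expR _) d1.
have d3 := @is_derive1_comp _ ph b x _ _ (der_ph _) (C1_is_derive xI).
have d4 := @is_deriveV _ (ph \o b) x _ _ (lt0r_neq0 (ph_gt0 (b x))) d3.
have := is_deriveM d2 d4; rewrite /GRing.scale/=.
set e := (X in is_derive _ _ _ X).
have -> // : e = - (G x * L (b x)).
by rewrite /e /G /k /L /logder; field; rewrite gt_eqF.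
Qed.

(** Freezing f outside [0, l] makes it continuous on the whole line, so that its
    compositions with the paths need no side conditions. *)
Definition clamp (a : R) := Num.max 0 (Num.min a l).

Lemma clamp_range a : 0 <= clamp a <= l.
Proof. by rewrite /clamp le_max lexx ge_max l0 ge_min lexx orbT. Qed.

Lemma clamp_id a : 0 <= a <= l -> clamp a = a.
Proof. by move=> /andP[a0 al]; rewrite /clamp min_l// max_r. Qed.

Let clamp_cont : continuous clamp.
Proof.
move=> x; apply: (@continuous_max _ _ (cst 0) (fun a => Num.min a l)).
  exact: cvg_cst.
by apply: (@continuous_min _ _ id (cst l)); [exact: cvg_id|exact: cvg_cst].
Qed.

(** The factor f.  With k the integrand in the formula to be proved, f * (ph o g)
    is the exponential of minus the integral of k over [theta - a, theta]; the
    derivative of b cancels in f'/f, which leaves (dph/ph) o g. *)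
Definition gauge (a : R) : R :=
  expR (\int[lebesgue_measure]_(t in `[0, theta - clamp a])
           ((db t - 1) * (dph (b t) / ph (b t)))
        - \int[lebesgue_measure]_(t in `[0, theta]) ((db t - 1) * (dph (b t) / ph (b t))))
  / ph (b (theta - clamp a)).

Let gaugeE a : gauge a = G (theta - clamp a). Proof. by []. Qed.

Lemma gauge_clamp a : gauge (clamp a) = gauge a.
Proof. by rewrite /gauge (clamp_id (clamp_range a)). Qed.

Lemma gauge_gt0 a : 0 < gauge a.
Proof. by rewrite divr_gt0 ?expR_gt0. Qed.

Lemma gauge_cont : continuous gauge.
Proof.
apply: (@continuous_within_comp _ G (fun a => theta - clamp a)); first exact: G_cont.
  by move=> x; apply: cvgB; [exact: cvg_cst|exact: clamp_cont].
move=> y; have /andP[h1 h2] := clamp_range y.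
by rewrite /= in_itv/=; apply/andP; split; have := ltheta; lra.
Qed.

Lemma gauge_is_derive a : 0 < a < l ->
  is_derive a 1 gauge (gauge a * (dph (g a) / ph (g a))).
Proof.
move=> /andP[a0 al].
have aI : 0 < theta - a < theta.
  by have := ltheta; move=> h; apply/andP; split; lra.
have d1 : is_derive a 1 (fun a => theta - a) (- 1).
  have := is_deriveB (is_derive_cst theta a 1) (is_derive_id a 1).
  by rewrite sub0r.
have d2 := @is_derive1_comp _ G (fun a => theta - a) a _ _ (G_der aI) d1.
have clampa : clamp a = a by rewrite clamp_id// !ltW.
have -> : gauge a * (dph (g a) / ph (g a)) = - (G (theta - a) * L (b (theta - a))) * - 1.
  by rewrite mulrN1 opprK gaugeE clampa.
apply: (near_eq_is_derive _ d2).
near=> y; rewrite gaugeE /= clamp_id//; apply/andP; split; apply: ltW.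
  by near: y; exact: lt_nbhsr.
by near: y; exact: lt_nbhsl.
Unshelve. all: by end_near. Qed.

Lemma gauge_start : gauge 0 * ph (g 0) = 1.
Proof.
rewrite /gauge clamp_id ?lexx// subr0 subrr expR0 /g subr0 mul1r mulVf//.
by rewrite gt_eqF.
Qed.

Lemma gauge_end : gauge l * ph (g l) =
  expR (- \int[lebesgue_measure]_(t in `[theta - l, theta])
     ((db t - 1) * (dph (b t) / ph (b t)))).
Proof.
rewrite gaugeE clamp_id ?l0 ?lexx// /G /g divfK ?gt_eqF//; congr expR.
have h := @Rintegral_itvB _ k (BLeft 0) (BRight theta) (theta - l) intk.
have tl : theta - l <= theta by rewrite gerBl.
have tl0 : 0 <= theta - l by rewrite subr_ge0 ltW.
move: h; rewrite !bnd_simp => /(_ tl0 tl).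
rewrite Rintegral_itv_obnd_cbnd; last first.
  by apply: integrableS intk => //; apply: subset_itv; rewrite bnd_simp.
move=> h; rewrite -[in RHS]/(\int[lebesgue_measure]_(t in `[theta - l, theta]) k t) -h.
by rewrite opprB.
Qed.

End boundary.

(** * Discounted passage times *)

Lemma integral_conull d (Omega : measurableType d) (R : realType)
    (P : probability Omega R) (D : set Omega) (Z : Omega -> R) :
  measurable D -> P (~` D) = 0%E -> P.-integrable setT (EFin \o Z) ->
  (\int[P]_(w in D) (Z w)%:E = (\int[P]_w Z w)%:E)%E.
Proof.
move=> mD PD iZ; have mN : measurable (~` D) by exact: measurableC.
have := negligible_integral mN measurableT iZ PD.
rewrite setTD setCK => <-.
by rewrite fineK//; exact: integrable_fin_num.
Qed.

Lemma Rintegral_close d (Omega : measurableType d) (R : realType)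
    (P : probability Omega R) (D : set Omega) (Y Z : Omega -> R) (c e : R) :
  measurable D -> P (~` D) = 0%E -> P.-integrable D (EFin \o Y) ->
  P.-integrable setT (EFin \o Z) -> 0 <= e ->
  (forall w, D w -> `|Y w - c * Z w| <= e) ->
  `|c * \int[P]_w Z w - \int[P]_(w in D) Y w| <= e.
Proof.
move=> mD PD iY iZ e0 close.
have iZD : P.-integrable D (EFin \o Z) by exact: integrableS iZ.
have icZ : P.-integrable D (EFin \o (fun w => c * Z w)).
  by have := integrableZl mD c iZD.
have -> : \int[P]_w Z w = \int[P]_(w in D) Z w.
  by rewrite [RHS]/Rintegral (integral_conull mD PD iZ).
rewrite -RintegralZl// distrC -RintegralB//.
have iB : P.-integrable D (EFin \o (fun w => Y w - c * Z w)).
  by have := integrableB mD iY icZ.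
apply: (le_trans (le_normr_Rintegral mD iB)).
have fD : (P D < +oo)%E := le_lt_trans (probability_le1 P mD) (ltry 1).
have ie : P.-integrable D (EFin \o cst e) by exact: finite_measure_integrable_cst.
have iN : P.-integrable D (EFin \o (fun w => `|Y w - c * Z w|)) by exact: integrable_norm.
apply: (le_trans (le_Rintegral mD iN ie close)).
rewrite Rintegral_cst//.
have : fine (P D) <= 1.
  rewrite -lee_fin fineK ?probability_le1// ge0_fin_numE//.
by move=> h; rewrite ler_piMr.
Qed.

Section main.
Context d (Omega : measurableType d) (R : realType) (P : probability Omega R).
Context (F : R -> set (set Omega)) (X A B : R -> Omega -> R).
Context (kappa beta sh delta theta c0 l : R) (b db : R -> R).
Context (usual : usual_filtration P F) (bm : brownian_motion P F B).
Context (sh0 : 0 < sh) (beta0 : 0 < beta) (delta0 : 0 < delta) (theta0 : 0 < theta)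
  (c00 : 0 < c0) (l0 : 0 <= l) (ltheta : l < theta).
Context (bC1 : C1_on theta b db).

Let g a := b (theta - a).
Let ph := phi kappa beta sh delta c0.
Let dph := dphi kappa beta sh delta c0.
Let f := gauge theta l b db ph dph.

Context (rou : reflected_OU P F B kappa beta sh theta g X A).

Let ph0 x : 0 < ph x. Proof. exact: phi_gt0. Qed.
Let dph0 x : 0 <= dph x. Proof. exact/ltW/dphi_gt0. Qed.
Let le_dph x y : x <= y -> dph x <= dph y. Proof. exact: ler_dphi. Qed.
Let le_ph x y : x <= y -> ph x <= ph y. Proof. exact: ler_phi. Qed.
Let der_ph (x : R) : is_derive x 1 ph (dph x). Proof. exact: is_derive_phi. Qed.
Let c_dph : continuous dph.
Proof. by move=> x; apply: continuous_dphi. Qed.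
Let g_contT : {within `[0, theta], continuous g}. Proof. exact: boundary_continuous bC1. Qed.
Let g_cont : {within `[0, l], continuous g}.
Proof.
move: g_contT; apply: continuous_subspaceW; apply: subset_itvl.
by rewrite bnd_simp ltW.
Qed.
Let f0 a : 0 < f a. Proof. exact: gauge_gt0. Qed.
Let f_cont : continuous f. Proof. exact: gauge_cont. Qed.
Let f_der (a : R) : 0 < a < l -> is_derive a 1 f (f a * (dph (g a) / ph (g a))).
Proof. exact: gauge_is_derive. Qed.

(** The paths on which all the almost sure properties hold.  Since F 0 contains the
    negligible sets, this set is measurable, and integrals can be restricted to
    it. *)
Let good : set Omega := [set w | [/\
  continuous_path X w /\ continuous_path A w,
  continuous_path B w,
  forall s t : R, 0 <= s -> s <= t -> A s w <= A t w,
  X 0 w = g 0 /\ A 0 w = 0 &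
  [/\ forall t : R, 0 <= t -> (t%:E <= tau theta A theta w)%E -> X t w <= g (A t w),
  forall t : R, 0 <= t -> (t%:E <= tau theta A theta w)%E ->
      X t w = X 0 w
        + \int[lebesgue_measure]_(s in `[0, t]) (kappa - beta * X s w)
        + sh * B t w - A t w &
  carried_by_contact g X A (tau theta A theta w) w]]].

Let good_negligible : P.-negligible (~` good).
Proof.
have H1 := rou_continuous rou.
have H2 := bm_continuous bm.
have H3 := rou_nondecreasing rou.
have H4 := rou_start rou.
have H5 := rou_below rou.
have H6 := rou_dynamics rou.
have H7 := rou_contact rou.
apply: negligibleS (negligibleU H1 (negligibleU H2 (negligibleU H3
  (negligibleU H4 (negligibleU H5 (negligibleU H6 H7)))))).
move=> w ng; apply: contrapT => /not_orP[/contrapT h1 /not_orP[/contrapT h2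
  /not_orP[/contrapT h3 /not_orP[/contrapT h4 /not_orP[/contrapT h5
  /not_orP[/contrapT h6 /contrapT h7]]]]]].
by apply: ng.
Qed.

Let negl_measurable N : P.-negligible N -> measurable N.
Proof. by move=> nN; exact: (usual_sub usual (lexx 0) (usual_complete usual nN)). Qed.

Let tauR w := inf [set t | 0 < t /\ (l < A t w \/ A t w = theta)].
Let cl := f l * ph (g l).
(** Z at the minimum of T and tau_l. *)
Let limY T w := if A T w <= l then expR (- (delta * T)) * (f (A T w) * ph (X T w))
  else expR (- (delta * tauR w)) * cl.

Let gm_ex : exists gm : R, forall a : R, 0 <= a <= l -> g a <= gm.
Proof.
have [c _ H] := EVT_max l0 g_cont; exists (g c) => a al.
by apply: H; rewrite in_itv.
Qed.

Let Mf_ex : exists Mf : R, forall a, f a <= Mf.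
Proof.
have [c _ H] := EVT_max l0 (continuous_subspaceT f_cont); exists (f c) => a.
by rewrite /f -gauge_clamp//; apply: H; rewrite in_itv/= clamp_range.
Qed.

Let path_cvg gm K T w : (forall a : R, 0 <= a <= l -> g a <= gm) -> gm + l <= K ->
  0 < T -> good w ->
  gridsum kappa beta sh delta T l gm K ph f n (X^~ w) (A^~ w) (B^~ w) @[n --> \oo]
    --> limY T w.
Proof.
move=> g_le gmK T0 [[cX cA] cB mA [X0 A0] [below dyn carried]].
have sub : `[0, T] `<=` `[0, +oo[%classic.
  by move=> t /=; rewrite !in_itv/= andbT => /andP[].
have at_theta (t : R) : A t w <= l -> (t%:E <= tau theta A theta w)%E.
  by move=> Al; apply: le_tau_theta => //; exact: le_lt_trans ltheta.
rewrite /limY /cl.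
apply: (path_limit (kappa := kappa) (g := g) (gm := gm) (tau := tauR w) T0 l0 gmK delta0 ph0 dph0 le_dph
  der_ph c_dph g_cont g_le (fun a _ => ltW (f0 a)) f_cont f_der beta0 sh0).
- exact: continuous_subspaceW cX.
- exact: continuous_subspaceW cA.
- exact: continuous_subspaceW cB.
- exact: A0.
- by move=> s t s0 st _; exact: mA.
- by move=> t /andP[t0 _] Al; apply: below => //; exact: at_theta.
- by move=> t /andP[t0 _] Al; apply: dyn => //; exact: at_theta.
- move=> s t s0 st tT Al Ast.
  have [u /andP[su ut] Xu] := contact_between mA carried s0 st (le_lt_trans Al ltheta) Ast.
  by exists u => //; rewrite ltW.
- exact: (tau_contact cX cA mA A0 l0 ltheta g_contT carried T0).
Qed.

Let disc w : R := fine (expeR (- (delta%:E * tau theta A l w))).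

Let disc01 w : 0 <= disc w <= 1.
Proof.
rewrite /disc; have : (0 <= tau theta A l w)%E.
  by apply: le_ereal_inf_tmp => _ [t [t0 _] <-]; rewrite lee_fin ltW.
case: (tau theta A l w) => [r| |//].
  rewrite lee_fin /= => r0; rewrite expR_ge0 expR_le1 oppr_le0.
  by rewrite mulr_ge0// ltW.
by rewrite gt0_muley ?lte_fin//= lexx ler01.
Qed.

(** The difference vanishes when tau_l < T; otherwise both terms carry a discount
    of at least T. *)
Let limY_disc T Mf gm K w : (forall a, f a <= Mf) ->
  (forall a : R, 0 <= a <= l -> g a <= gm) -> gm <= K -> 0 < T -> good w ->
  `|limY T w - cl * disc w| <= (Mf * ph K + cl) * expR (- (delta * T)).
Proof.
move=> fM g_le gmK T0 [_ _ mA [X0 A0] [below _ _]].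
have cl0 : 0 < cl by rewrite mulr_gt0.
have e0 := expR_ge0 (- (delta * T)).
have Mf0 : 0 <= Mf := le_trans (ltW (f0 0)) (fM 0).
rewrite /limY; case: ifPn => [AT|]; last first.
  rewrite -ltNge => AT; rewrite /disc (tau_fin ltheta T0 AT)/= mulrC subrr normr0.
  apply: mulr_ge0 => //; apply: addr_ge0; last exact: ltW.
  by apply: mulr_ge0 => //; exact: ltW.
have T_tau : (T%:E <= tau theta A l w)%E by exact: le_tau.
have dT : disc w <= expR (- (delta * T)).
  rewrite /disc; case: (tau theta A l w) T_tau => [r| |]//=.
    by rewrite lee_fin => Tr; rewrite ler_expR lerN2 ler_pM2l.
  by rewrite gt0_muley ?lte_fin.
have /andP[d0 _] := disc01 w.
have AT0 : 0 <= A T w by rewrite -A0 mA// ltW.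
have XK : X T w <= K.
  apply: le_trans gmK; apply: (@le_trans _ _ (g (A T w))); last by rewrite g_le// AT0.
  by apply: below; [exact: ltW|apply: le_tau_theta => //; exact: le_lt_trans ltheta].
apply: (le_trans (ler_normB _ _)); rewrite mulrDl; apply: lerD.
  rewrite ger0_norm; last by rewrite mulr_ge0// mulr_ge0 ?ltW.
  rewrite mulrC ler_wpM2r//; apply: ler_pM; rewrite ?(ltW (f0 _)) ?(ltW (ph0 _))//.
  exact: le_ph.
rewrite ger0_norm; first by rewrite ler_pM2l.
exact: (mulr_ge0 (ltW cl0) d0).
Qed.

Let mgood : measurable good.
Proof. by rewrite -(setCK good); apply: measurableC; exact: negl_measurable. Qed.

Let Pgood : P (~` good) = 0%E.
Proof. by apply: measure_negligible good_negligible; exact: measurableC. Qed.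

Let limY_mean gm K T Mf : (forall a : R, f a <= Mf) ->
  (forall a : R, 0 <= a <= l -> g a <= gm) -> gm + l < K -> gm < K -> 0 < T ->
  P.-integrable good (EFin \o limY T) /\
  (\int[P]_(w in good) (limY T w)%:E = 1)%E.
Proof.
move=> fM g_le glK gK T0.
have [aX aA] := rou_adapted rou.
have [C C0 HC] := phi_step_grid kappa beta0 sh0 delta0 c00 gK T0.
have ph0' x : 0 <= ph x by exact/ltW/ph0.
have mph : measurable_fun setT ph by exact: measurable_phi.
have mf : measurable_fun setT f by exact: continuous_measurable_fun.
have f0' a : 0 <= f a by exact/ltW/f0.
have iS := gridsum_integrable usual bm aX aA l T0 (ltW delta0) ph0' mph le_ph
  (ltW gK) f0' mf fM C0 HC.
have mS := gridsum_mean usual bm aX aA l T0 (ltW delta0) ph0' mph le_ph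
  (ltW gK) f0' mf fM C0 HC.
have iV := integrable_value usual bm aX aA kappa beta sh l T0 (ltW delta0) ph0' mph le_ph
  (ltW gK) f0' mf fM.
pose S n w := gridsum kappa beta sh delta T l gm K ph f n (X^~ w) (A^~ w) (B^~ w).
have [M HM] := gridsum_bounded kappa beta sh T0 l0 (ltW glK) delta0 ph0 dph0 le_dph
  der_ph c_dph g_cont (fun a _ => f0' a) f_cont f_der.
have Scvg w : good w -> S n w @[n --> \oo] --> limY T w.
  by move=> gw; apply: path_cvg => //; exact: ltW.
have mSn n : measurable_fun good (EFin \o S n).
  by apply: measurable_funTS; exact: measurable_int (iS n).
have mY : measurable_fun good (EFin \o limY T).
  apply/measurable_EFinP; apply: (measurable_fun_cvg (h := S)) => //.
  by move=> n; exact/measurable_EFinP.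
have iM : P.-integrable good (EFin \o cst M).
  apply: integrableS (bounded_integrable P (c := `|M|) (measurable_cst M) _) => //.
have cvg_ae : {ae P, forall w, good w -> (S n w)%:E @[n --> \oo] --> (limY T w)%:E}.
  by apply: aeW => w gw; apply: cvg_EFin; [exact: nearW|exact: Scvg].
have bnd_ae : {ae P, forall w n, good w -> (`|(S n w)%:E| <= (M%:E : \bar R))%E}.
  apply: aeW => w n [_ _ mA [_ A0] _]; rewrite lee_fin; apply: HM => //.
  by move=> s t s0 st _; exact: mA.
have [iY _ lim] := dominated_convergence mgood mSn mY cvg_ae iM bnd_ae.
split; first exact: iY.
have S1 n : (\int[P]_(w in good) (S n w)%:E = (\int[P]_w S n w)%:E)%E.
  exact: integral_conull mgood Pgood (iS n).
have V1 n : \int[P]_w value kappa beta sh delta T l gm ph f n (X^~ w) (A^~ w) (B^~ w) 0 = 1.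
  have Pg1 : P good = 1%E.
    by have := probability_setC P (measurableC mgood); rewrite setCK Pgood sube0.
  have h := integral_conull mgood Pgood (iV n 0).
  apply: EFin_inj; rewrite -[LHS]h -Pg1 -(mul1e (P good)) -integral_cst//.
  apply: eq_integral => w /[!inE] -[_ _ mA [X0 A0] _]; congr EFin.
  rewrite /value /weight tick0 X0 A0 mulr0 oppr0 expR0 mulr1.
  have -> : alive kappa beta sh T l gm n (X^~ w) (A^~ w) (B^~ w) 0.
    by rewrite /= /within_bounds tick0 A0 X0 l0 big_ord0 ler01 g_le// lexx l0.
  by rewrite mul1r gauge_start.
apply: (cvg_unique _ lim) => //.
rewrite (_ : (fun n => _) = (fun n => (\int[P]_w S n w)%:E)); last exact/funext.
apply: cvg_EFin; first exact: nearW.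
apply/cvgrPdist_le => e e0.
exists (Num.truncn (Mf * C / e)) => // n /= nN.
rewrite distrC -(V1 n); apply: (le_trans (mS n)).
rewrite ler_pdivrMr ?ltr0n// -ler_pdivrMl// mulrC.
by apply: (le_trans (ltW (truncnS_gt _))); rewrite ler_nat ltnS.
Qed.

(** E[limY T] = 1 for all T, and limY T is uniformly close to [cl * disc] when T is
    large.  Measurability of [disc] also comes from this limit. *)
Lemma discounted_mean :
  (\int[P]_w (disc w)%:E = (expR (\int[lebesgue_measure]_(x in `[(theta - l), theta])
     ((db x - 1) * (dph (b x) / ph (b x)))))%:E)%E.
Proof.
have [gm g_le] := gm_ex.
have [Mf fM] := Mf_ex.
pose K := gm + l + 1.
have gK : gm < K by rewrite /K; have := l0; lra.
have glK : gm + l < K by rewrite /K; lra.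
have mean T : 0 < T -> _ := fun T0 => limY_mean fM g_le glK gK T0.
have cl0 : 0 < cl by rewrite mulr_gt0.
pose M := Mf * ph K + cl.
have close T w : 0 < T -> good w -> `|limY T w - cl * disc w| <= M * expR (- (delta * T)).
  by move=> T0 gw; exact: limY_disc fM g_le (ltW gK) T0 gw.
have M0 : 0 <= M.
  by rewrite addr_ge0 ?(ltW cl0)// mulr_ge0 ?(ltW (ph0 _))// (le_trans (ltW (f0 0))).
have small e : 0 < e -> exists2 N, 0 < N & forall T : R, N <= T -> M * expR (- (delta * T)) <= e.
  move=> e0.
  have N0 : 0 < M / (delta * e) + 1.
    by apply: ltr_wpDl; [exact/divr_ge0/ltW/mulr_gt0|exact: ltr01].
  exists (M / (delta * e) + 1) => [//|T NT].
  have T0 : 0 < T by exact: lt_le_trans NT.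
  have dT : 0 < delta * T by rewrite mulr_gt0.
  rewrite expRN ler_pdivrMr ?expR_gt0//.
  have h : delta * T <= expR (delta * T) by have := expR_ge1Dx (delta * T); lra.
  apply: (@le_trans _ _ (e * (delta * T))); last by rewrite ler_pM2l.
  have NT' : M / (delta * e) <= T by apply: le_trans NT; rewrite lerDl.
  by move: NT'; rewrite ler_pdivrMr ?mulr_gt0//; lra.
have mdisc : measurable_fun good disc.
  have cvgd w : good w -> limY m.+1%:R w / cl @[m --> \oo] --> disc w.
    move=> gw.
    have h : limY m.+1%:R w @[m --> \oo] --> cl * disc w.
      apply/cvgrPdist_le => e e0.
      have [N N0 HN] := small e e0.
      exists (Num.truncn N) => // m /= Nm; rewrite distrC.
      apply: (le_trans (close _ _ (ltr0Sn _ _) gw)); apply: HN.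
      by apply: (le_trans (ltW (truncnS_gt _))); rewrite ler_nat ltnS.
    have -> : disc w = cl * disc w / cl by rewrite mulrAC divff ?mul1r// lt0r_neq0.
    exact: cvgM h (cvg_cst cl^-1).
  apply: (measurable_fun_cvg (h := fun m w => limY m.+1%:R w / cl)) => // m.
  apply: measurable_funM => //.
  have [iY _] := mean _ (ltr0Sn R m).
  by apply/measurable_EFinP; exact: measurable_int iY.
have mdiscT : measurable_fun setT disc.
  move=> _ U mU; rewrite setTI.
  rewrite -(setIT (disc @^-1` U)) -(setUv good) setIUr.
  apply: measurableU; first by rewrite setIC; exact: mdisc.
  apply: negl_measurable; apply: negligibleS good_negligible.
  exact: subIsetr.
have idisc : P.-integrable setT (EFin \o disc).
  apply: (bounded_integrable P (c := 1)) => // w.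
  by have /andP[d0 d1] := disc01 w; rewrite ger0_norm.
have eqn : cl * \int[P]_w disc w = 1.
  apply/eqP; rewrite -subr_eq0 -normr_le0; apply/ler_addgt0Pl => e e0; rewrite addr0.
  have [N N0 HN] := small e e0.
  have [iY Y1] := mean _ N0.
  have -> : 1 = \int[P]_(w in good) limY N w by rewrite /Rintegral Y1.
  apply: (Rintegral_close mgood Pgood iY idisc (ltW e0)) => w gw.
  exact: le_trans (close _ _ N0 gw) (HN _ (lexx N)).
rewrite -[LHS]fineK; last exact: integrable_fin_num.
congr EFin; apply: (mulfI (lt0r_neq0 cl0)).
rewrite [LHS]eqn [X in X * _](gauge_end l0 ltheta bC1 ph0 der_ph c_dph : cl = _).
by rewrite -expRD addNr expR0.
Qed.

End main.

Lemma PhiE (R : realType) (sigma sh beta rho delta : R) :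
  Phi sigma sh beta rho delta =
    phi (sigma * rho * sh) beta sh delta (Gamma (delta / beta))^-1.
Proof. by apply/funext => x; rewrite /Phi /hermite mulNr opprK. Qed.

Theorem theorem4p3 (R : realType) (d : measure_display)
    (Omega : measurableType d) (P : probability Omega R)
    (F : R -> set (set Omega)) (B : R -> Omega -> R)
    (sigma sh beta rho delta : R) (theta : R) (b db : R -> R)
    (X A : R -> Omega -> R) :
  usual_filtration P F ->
  brownian_motion P F B ->
  0 < sigma -> 0 < sh -> 0 < beta -> -1 <= rho <= 1 -> 0 < delta ->
  0 < theta ->
  C1_on theta b db ->
  (forall x : R, x \in `[0, theta] -> db x < 0) ->
  reflected_OU P F B (sigma * rho * sh) beta sh theta
    (fun a => b (theta - a)) X A ->
  forall l : R, 0 <= l -> l < theta ->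
    ('E_P[fun w => fine (expeR (- (delta%:E * tau theta A l w)))] =
      (expR (\int[lebesgue_measure]_(x in `[theta - l, theta])
        ((db x - 1) * (derive1 (Phi sigma sh beta rho delta) (b x)
                        / Phi sigma sh beta rho delta (b x)))))%:E)%E.
Proof.
move=> usual bm _ sh0 beta0 _ delta0 theta0 bC1 _ rou l l0 ltheta.
have c0 : 0 < (Gamma (delta / beta))^-1 by rewrite invr_gt0 Gamma_gt0// divr_gt0.
rewrite unlock PhiE.
have -> : derive1 (phi (sigma * rho * sh) beta sh delta (Gamma (delta / beta))^-1) =
    dphi (sigma * rho * sh) beta sh delta (Gamma (delta / beta))^-1.
  apply/funext => x; rewrite derive1E.
  by apply: derive_val; exact: is_derive_phi.
exact: discounted_mean usual bm sh0 beta0 delta0 theta0 c0 l0 ltheta bC1 rou.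
Qed.
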